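(* Let $\mathbb{K}$ be a field with an automorphism $a\mapsto\overline{a}$ of order two and let $\mathbb{F}$ be its fixed field. Let $f\in\mathbb{F}[x_1,\dots,x_m]$ be a polynomial of total degree $n\leq m$ that is multiaffine in $x_1,\dots,x_n$ and whose coefficient of $x_1\cdots x_n$ equals one. There exist $n\times n$ Hermitian matrices $A_{n+1},\dots,A_m,A_0$ over $\mathbb{K}$ such that $$f=\det\Big(\mathrm{diag}(x_1,\dots,x_n)+\sum_{j=n+1}^m x_jA_j+A_0\Big)$$ if and only if for all $i,j\in\{1,\dots,n\}$, $\Delta_{ij}(f)$ is a Hermitian square in $\mathbb{K}[x_1,\dots,x_m]$.
   Context: Multiaffine in $x_1,\dots,x_n$ means of degree at most $1$ in each of these variables. The Rayleigh difference is $\Delta_{ij}(f)=\frac{\partial f}{\partial x_i}\frac{\partial f}{\partial x_j}-f\,\frac{\partial^2f}{\partial x_i\partial x_j}$. The involution extends to $\mathbb{K}[x_1,\dots,x_m]$ by acting on coefficients; $q\in\mathbb{F}[x_1,\dots,x_m]$ is a Hermitian square if $q=g\overline{g}$ for some $g\in\mathbb{K}[x_1,\dots,x_m]$. A matrix $A$ over $\mathbb{K}$ is Hermitian if $A=\overline{A}^T$. *)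

(* Defs.v *)
From HB Require Import structures.
From mathcomp Require Export all_boot all_order all_algebra.
From mathcomp Require Export sesquilinear mpoly.

Set Implicit Arguments.
Unset Strict Implicit.
Unset Printing Implicit Defensive.

Import GRing.Theory.
Local Open Scope ring_scope.

Definition fixed_field (K : fieldType) (conj : involutive_rmorphism K) :
  {pred K} := [pred a | conj a == a].

Definition multiaffine (K : fieldType) (m : nat) (P : pred 'I_m)
    (f : {mpoly K[m]}) : Prop :=
  forall i : 'I_m, P i ->
  forall u : 'X_{1..m}, u \in msupp f -> (u i <= 1)%N.

(* The exponent vector of 'X_0 * ... * 'X_(n-1). *)
Definition mnm_first (m n : nat) : 'X_{1..m} :=
  [multinom nat_of_bool (i < n)%N | i < m].

Definition rayleigh (K : fieldType) (m : nat) (i j : 'I_m) (f : {mpoly K[m]}) :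
  {mpoly K[m]} :=
  mderiv i f * mderiv j f - f * mderiv i (mderiv j f).

Definition hermitian_square (K : fieldType) (conj : involutive_rmorphism K)
    (m : nat) (q : {mpoly K[m]}) : Prop :=
  q \is a mpolyOver m (fixed_field conj) /\
  exists g : {mpoly K[m]}, q = g * map_mpoly conj g.

(* The variables and the coefficient matrices share the index type 'I_m, so the
   entries A j with j < n are not used. *)
Definition linear_pencil (K : fieldType) (m n : nat) (le_nm : (n <= m)%N)
    (A : 'I_m -> 'M[K]_n) (A0 : 'M[K]_n) : 'M[{mpoly K[m]}]_n :=
  diag_mx (\row_(i < n) ('X_(widen_ord le_nm i) : {mpoly K[m]}))
  + \sum_(j < m | (n <= j)%N)
      ('X_j : {mpoly K[m]}) *: map_mx (@mpolyC m K) (A j)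
  + map_mx (@mpolyC m K) A0.

(* Main.v *)
Require Import Defs.
From HB Require Import structures.
From mathcomp Require Import all_boot all_order all_algebra.
From mathcomp Require Import sesquilinear mpoly.
From mathcomp Require Import perm qpoly qfpoly generic_quotient fraction ring.
From Stdlib Require Classical_Prop.

Set Implicit Arguments.
Unset Strict Implicit.
Unset Printing Implicit Defensive.

Import GRing.Theory.
Local Open Scope ring_scope.

(* If f = det M, differentiating M * adj M = f gives
   Delta_ij f = adj_ij * adj_ji.

   For the converse, remove the last variable t, by induction on the number of
   variables. Over the fraction field of K[t], the induction hypothesis
   represents f divided by its coefficient u at the product of the remaining
   x_i. All principal minors of the matrix are derivatives of f, up to powers of
   u, hence polynomial in t. So no cycle of entries has a denominator, and
   conjugating by diagonal matrices moves the denominators out of all entries,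
   one irreducible factor of K[t] at a time, without losing the Hermitian
   symmetry.
   - If t is one of x_(n+1), .., x_m, then u = 1 and the entries are affine by
     degree reasons: an off-diagonal entry times its conjugate is a 2x2 minor.
   - If t is one of x_1, .., x_n, then u = t + a, and u times the matrix is, up
     to multiples of u, a constant matrix A whose 2x2 minors vanish and whose
     diagonal entries are opposites of Hermitian squares. So A = - w^* w, and
     the matrix is the Schur complement of u in the bordered matrix sought. *)

(** * Determinants and derivations *)

Definition derivation (R : nzRingType) (d : R -> R) : Prop :=
  (forall x y, d (x + y) = d x + d y) /\
  (forall x y, d (x * y) = d x * y + x * d y).

Section Derivation.
Variables (R : comNzRingType) (d : R -> R).
Hypothesis d_deriv : derivation d.
Let dD : forall x y, d (x + y) = d x + d y. Proof. by case: d_deriv. Qed.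
Let dM : forall x y, d (x * y) = d x * y + x * d y. Proof. by case: d_deriv. Qed.

Lemma derivation0 : d 0 = 0.
Proof. by apply: (addrI (d 0)); rewrite -dD !addr0. Qed.

Lemma derivation1 : d 1 = 0.
Proof.
by apply: (addrI (d 1)); rewrite addr0 -{3}[1](mulr1 1) dM mulr1 mul1r.
Qed.

Lemma derivation_sign k : d ((-1) ^+ k) = 0.
Proof.
have dN1 : d (-1) = 0.
  by apply: (addrI (d 1)); rewrite -dD subrr derivation0 derivation1 addr0.
elim: k => [|k IHk]; first by rewrite expr0 derivation1.
by rewrite exprS dM dN1 IHk mul0r mulr0 addr0.
Qed.

Lemma derivation_sum I (r : seq I) (P : pred I) (F : I -> R) :
  d (\sum_(i <- r | P i) F i) = \sum_(i <- r | P i) d (F i).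
Proof. by apply: (big_morph d dD); apply: derivation0. Qed.

Lemma derivation_det0 n (M : 'M[R]_n) :
  (forall i j, d (M i j) = 0) -> d (\det M) = 0.
Proof.
move=> dM0; rewrite /determinant derivation_sum big1 // => s _.
rewrite dM derivation_sign mul0r add0r.
suff -> : d (\prod_i M i (s i)) = 0 by rewrite mulr0.
apply: (big_ind (fun x => d x = 0)) => [|x y dx dy|i _]; first exact: derivation1.
- by rewrite dM dx dy mul0r mulr0 addr0.
- exact: dM0.
Qed.

(** Laplace expansion along row [i]: the cofactors of that row involve only entries killed by [d],
    so only the term at the entry [(i, i)] contributes. *)
Lemma derivation_det n (c : R) (M : 'M[R]_n) (i : 'I_n) :
  (forall a b, d (M a b) = c *+ ((a == i) && (b == i))) ->
  d (\det M) = c * (\adj M) i i.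
Proof.
move=> dMab; rewrite (expand_det_row M i) derivation_sum.
have dcof j : d (cofactor M i j) = 0.
  rewrite /cofactor dM derivation_sign mul0r add0r derivation_det0 ?mulr0 //.
  move=> a b; rewrite !mxE dMab.
  by rewrite [lift i a == i]eq_sym (negPf (neq_lift _ _)).
rewrite (bigD1 i) //= big1 ?addr0 => [|j ji]; last first.
  by rewrite dM dcof mulr0 addr0 dMab (negPf ji) andbF mul0r.
by rewrite dM dcof mulr0 addr0 dMab eqxx mulr1n mxE.
Qed.
End Derivation.

Lemma adj_diag (R : comNzRingType) n (M : 'M[R]_n.+1) (i : 'I_n.+1) :
  (\adj M) i i = \det (mxsub (lift i) (lift i) M).
Proof.
rewrite mxE /cofactor addnn -signr_odd odd_double expr0 mul1r; congr (\det _).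
by apply/matrixP => a b; rewrite !mxE.
Qed.

Lemma det_mxsub_inj (R : comNzRingType) n (M : 'M[R]_n) (phi : 'I_n -> 'I_n) :
  injective phi -> \det (mxsub phi phi M) = \det M.
Proof.
move=> phi_inj; pose s := perm phi_inj.
have -> : mxsub phi phi M = row_perm s (col_perm s M).
  by apply/matrixP => i j; rewrite !mxE !permE.
rewrite row_permE col_permE !det_mulmx !det_perm odd_permV mulrCA.
by rewrite -expr2 sqrr_sign mulr1.
Qed.

(** A derivation whose index lies outside the image of [phi] deletes its row and column at the price
    of a factor [c]. After all such indices have been used, the principal minor on the image of
    [phi] remains; so principal minors are read off from derivatives of the determinant alone. *)
Lemma minor_deriv (R : comNzRingType) (c : R) n (D : 'I_n -> R -> R)
    (M : 'M[R]_n) k (phi : 'I_k -> 'I_n) :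
  (forall i, derivation (D i)) -> (forall i, D i c = 0) ->
  (forall i a b, D i (M a b) = c *+ ((a == i) && (b == i))) ->
  injective phi ->
  exists s : seq 'I_n, (size s + k = n)%N /\
    foldr D (\det M) s = c ^+ (size s) * \det (mxsub phi phi M).
Proof.
elim: n => [|n IHn] in D M k phi *.
  move=> _ _ _ _; case: k phi => [|k] phi; last by case: (phi ord0).
  by exists [::]; split; rewrite //= !det_mx00 mulr1.
move=> Dd Dc DM phi_inj.
have le_kn : (k <= n.+1)%N.
  by have := leq_card phi phi_inj; rewrite !card_ord.
have [kn|] := eqVneq k n.+1.
  case: _ / (esym kn) phi phi_inj => phi phi_inj; exists [::].
  by split; rewrite //= mul1r det_mxsub_inj.
rewrite neq_ltn [(n.+1 < k)%N]ltnNge le_kn orbF => lt_kn.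
have [i iP] : exists i, forall j, phi j != i.
  have /subsetPn[i _ iP] : ~~ ([set: 'I_n.+1] \subset codom phi).
    apply/negP => /subset_leq_card; rewrite cardsT card_ord card_codom //.
    by rewrite card_ord leqNgt lt_kn.
  by exists i => j; apply: contraNneq iP => <-; apply: codom_f.
have psiP j : {l | phi j = lift i l}.
  by case: (unliftP i (phi j)) (iP j) => [l ->|->]; [exists l | rewrite eqxx].
pose psi j := sval (psiP j).
have phiE j : phi j = lift i (psi j) by rewrite /psi; case: (psiP j).
have psi_inj : injective psi.
  by move=> a b ab; apply: phi_inj; rewrite !phiE ab.
pose D' l := D (lift i l).
have := IHn D' (mxsub (lift i) (lift i) M) k psi.
case=> // [l|l|l a b|s [s_size sE]].
- exact: Dd.
- exact: Dc.
- by rewrite mxE /D' DM !(inj_eq (@lift_inj _ i)).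
have DcM l x : D l (c * x) = c * D l x.
  by case: (Dd l) => _ ->; rewrite Dc mul0r add0r.
(* [foldr] starts from the end of the list, so [D i] acts first, on the full determinant. *)
exists (rcons (map (lift i) s) i).
split; first by rewrite size_rcons size_map addSn s_size.
rewrite foldr_rcons (derivation_det (Dd i) (DM i)) adj_diag size_rcons size_map exprS.
have -> : forall x, foldr D (c * x) (map (lift i) s) = c * foldr D' x s.
  by move=> x; elim: (s) => //= l t ->; rewrite DcM.
rewrite sE mulrA; congr (_ * \det _).
by apply/matrixP => a b; rewrite !mxE !phiE.
Qed.

(** * Clearing a prime from a Hermitian matrix *)

Section Cycles.
Variables (R D : idomainType) (rho : {rmorphism R -> D}) (pi : R) (quo : R -> R).
Hypotheses (pi_neq0 : pi != 0) (rho_pi : rho pi = 0).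
Hypothesis rho0 : forall x, rho x = 0 -> x = pi * quo x.

(** The kernel of [rho] is the ideal generated by [pi], so these two predicates express divisibility
    by [pi] and by its square, using the quotient [quo] chosen on that kernel. *)
Definition divisible1 x := rho x == 0.
Definition divisible2 x := (rho x == 0) && (rho (quo x) == 0).

Lemma divisible2W x : divisible2 x -> divisible1 x.
Proof. by case/andP. Qed.

(* Dividing by [pi] the rows whose superdiagonal entry is divisible by [pi]
   leaves a matrix that is, modulo [pi], triangular up to a cyclic shift of its
   columns, with nonzero entries on the shifted diagonal. *)
Lemma det_shifted_triangular k (M : 'M[R]_k.+1) (G : R) :
  (forall a b : 'I_k.+1, b = a.+1 :> nat -> ~~ divisible2 (M a b)) ->
  ~~ divisible1 (M ord_max ord0) ->
  (forall a b : 'I_k.+1, (a.+1 < b)%N -> divisible2 (M a b)) ->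
  (forall a b : 'I_k.+1, (b <= a)%N -> (a != ord_max) || (b != ord0) ->
     divisible1 (M a b)) ->
  \det M <> pi ^+ k.+1 * G.
Proof.
move=> Msucc Mlast Mfwd Mback detM.
pose w (a : 'I_k.+1) := [exists b : 'I_k.+1, (b == a.+1 :> nat) && divisible1 (M a b)].
have w_max : w ord_max = false.
  by apply/existsP => -[b /andP[/eqP bE _]]; have := ltn_ord b; rewrite bE ltnn.
have wE (a b : 'I_k.+1) : b = a.+1 :> nat -> w a = divisible1 (M a b).
  move=> ab; apply/existsP/idP => [[b' /andP[/eqP b'E]]|dab]; last first.
    by exists b; rewrite ab eqxx.
  by congr (is_true (divisible1 (M a _))); apply: val_inj; rewrite /= b'E ab.
have w_row a b : w a -> divisible1 (M a b).
  move=> wa; case: (ltngtP b a.+1) => [|ab|ab].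
  - rewrite ltnS => ba; apply: Mback => //; case: eqP => // am.
    by rewrite am w_max in wa.
  - exact/divisible2W/Mfwd.
  - by rewrite -(wE _ _ ab).
pose N := \matrix_(a, b) (if w a then quo (M a b) else M a b).
have ME : M = diag_mx (\row_a pi ^+ w a) *m N.
  apply/matrixP => a b; rewrite mul_diag_mx !mxE.
  case: ifP => wa; last by rewrite mul1r.
  by rewrite expr1 -rho0 //; apply/eqP/w_row.
pose W := (\sum_a w a)%N.
(* The last row has no superdiagonal entry, so at most [k] of the [k.+1] factors [pi] are taken out
   and [pi] still divides [\det N]. *)
have le_Wk : (W <= k)%N.
  rewrite /W big_ord_recr /= w_max addn0 -[leqRHS]card_ord -sum1_card.
  by apply: leq_sum => i _; case: (w _).
have detN : \det N = pi ^+ (k.+1 - W) * G.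
  have /mulfI : pi ^+ W != 0 by rewrite expf_neq0.
  apply; rewrite mulrA -exprD subnKC; last exact: leqW.
  rewrite -detM ME det_mulmx det_diag /W expr_sum; congr (_ * _).
  by apply: eq_bigr => a _; rewrite mxE.
(* Modulo [pi] only the first entry of the last row survives, and its cofactor is triangular with
   nonzero diagonal. *)
have : rho (\det N) != 0.
  rewrite -det_map_mx (expand_det_row _ ord_max) (bigD1 ord0) //= big1.
    rewrite addr0 mulf_neq0 //; first by rewrite !mxE w_max.
    rewrite /cofactor mulf_neq0 ?signr_eq0 // det_trig.
      apply/prodf_neq0 => i _; rewrite !mxE.
      have ab : lift ord0 i = (lift ord_max i).+1 :> nat by rewrite lift_max.
      rewrite (wE _ _ ab); have := Msucc _ _ ab.
      by rewrite negb_and /divisible1; case: (rho (M _ _) == 0) / eqP => //= /eqP.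
    apply/is_trig_mxP => i j lt_ij; rewrite !mxE; apply/eqP.
    have /Mfwd/andP[d1 d2] : ((lift ord_max i).+1 < lift ord0 j)%N.
      by rewrite lift_max.
    by case: ifP.
  move=> b b0; rewrite !mxE w_max (eqP (Mback _ _ _ _)) ?mul0r ?b0 ?orbT //.
  exact: leq_ord.
by rewrite detN rmorphM rmorphXn rho_pi subSn // exprS !mul0r eqxx.
Qed.

(** Entries not divisible by the square of [pi] are the edges of a graph, and [c] is a walk in it. A
    counterexample of least length repeats no vertex and admits no shortcut, so the principal minor
    on its vertices is shifted triangular, which contradicts its divisibility by [pi ^+ k.+1]. *)
Lemma cycle_divisible n (M : 'M[R]_n) :
  (forall k (phi : 'I_k.+1 -> 'I_n), injective phi ->
     exists G, \det (mxsub phi phi M) = pi ^+ k.+1 * G) ->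
  forall k (c : nat -> 'I_n),
  (forall a, (a < k)%N -> ~~ divisible2 (M (c a) (c a.+1))) ->
  divisible1 (M (c k) (c 0%N)).
Proof.
move=> minors; elim/ltn_ind=> k IHk c c_path.
have shortcut a b : (a.+1 < b <= k)%N -> ~~ divisible2 (M (c a) (c b)) ->
    divisible1 (M (c k) (c 0%N)).
  move=> /andP[ab bk] dab; pose d := (b - a.+1)%N.
  pose c' x := if (x <= a)%N then c x else c (x + d)%N.
  have d_gt0 : (0 < d)%N by rewrite subn_gt0.
  have dE : (a.+1 + d = b)%N by rewrite subnKC // ltnW.
  have le_dk : (d <= k)%N by apply: leq_trans bk; rewrite -dE leq_addl.
  have lt_dk : (k - d < k)%N by rewrite ltn_subrL d_gt0 (leq_trans _ bk) // -dE.
  have lt_adk : (a < k - d)%N by rewrite ltn_subRL addnC (leq_trans _ bk) // -dE.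
  have -> : c k = c' (k - d)%N by rewrite /c' leqNgt lt_adk subnK.
  apply: (IHk _ lt_dk c') => x x_lt; rewrite /c'; case: (ltngtP x a) => [xa|ax|->].
  - by apply: c_path; apply: ltn_trans xa (leq_trans lt_adk (leq_subr _ _)).
  - by rewrite addSn c_path // addnC -ltn_subRL.
  - by rewrite dE.
case: (boolP (divisible1 _)) => // last_bad.
have c_inj : {in [pred x | x <= k] &, injective c}%N.
  suff c_neq a b : (a < b <= k)%N -> c a = c b -> False.
    move=> a b ak bk cab; case: (ltngtP a b) => // ab; exfalso.
      by apply: (c_neq a b) => //; rewrite ab.
    by apply: (c_neq b a) => //; rewrite ab.
  (* If the repeated vertex is the last one, the walk can stop at its first visit, at [a]; otherwise
     the edge leaving position [b] also leaves position [a] and gives a shortcut. *)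
  move=> /andP[ab]; rewrite leq_eqVlt => /orP[/eqP bk|bk] cab.
    case/negP: last_bad; rewrite -bk -cab; apply: IHk; first by rewrite -bk.
    by move=> x xa; apply: c_path; rewrite -bk (ltn_trans xa).
  case/negP: last_bad; apply: (shortcut a b.+1); first by rewrite ltnS ab.
  by rewrite cab c_path.
pose phi (i : 'I_k.+1) := c i.
have phi_inj : injective phi.
  by move=> i j /c_inj ij; apply/val_inj/ij; rewrite inE leq_ord.
have [G detG] := minors k phi phi_inj.
exfalso; apply: (det_shifted_triangular _ _ _ _ detG) => [a b ab||a b ab|a b ab].
- by rewrite mxE /phi ab c_path // -ltnS -ab.
- by rewrite mxE.
- rewrite mxE; apply: contraR last_bad => dab.
  by apply: (shortcut a b) => //; rewrite ab leq_ord.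
(* An entry below the shifted diagonal closes the part of the walk from [b] to [a], which is
   strictly shorter. *)
move=> ab_neq; rewrite mxE; case: (boolP (divisible1 _)) => // dab.
have lt_abk : (a - b < k)%N.
  move: ab_neq ab; rewrite -!(inj_eq val_inj) /=; have := leq_ord a.
  case: (nat_of_ord b) => [|b' ak _ ba]; last first.
    by rewrite ltn_subLR // addSn ltnS (leq_trans ak) // leq_addl.
  by rewrite orbF subn0 ltn_neqAle => -> ->.
have := IHk _ lt_abk (fun x => c (x + b)%N); rewrite subnK // (negPf dab).
apply=> x x_lt; rewrite addSn c_path // addnC.
by rewrite (leq_trans _ (leq_ord a)) // -ltn_subRL.
Qed.
End Cycles.

Section Balancing.
Variables (R D : idomainType) (rho : {rmorphism R -> D}) (pi : R) (quo : R -> R).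
Hypotheses (pi_neq0 : pi != 0) (rho_pi : rho pi = 0).
Hypothesis rho0 : forall x, rho x = 0 -> x = pi * quo x.
Variable sigma : {rmorphism R -> R}.
Hypothesis sigmaK : involutive sigma.
Variable Q : R -> Prop.
Hypotheses (Q_pi : forall x, Q (pi * x) <-> Q x)
           (Q_sigma : forall x, Q x -> Q (sigma x)).

Let sigma_pi_neq0 : sigma pi != 0.
Proof. by apply: contraNneq pi_neq0 => s0; rewrite -[pi]sigmaK s0 rmorph0. Qed.

Let Q_sigma_pi x : Q x -> Q (sigma pi * x).
Proof. by move=> Qx; rewrite -[x]sigmaK -rmorphM; apply/Q_sigma/Q_pi/Q_sigma. Qed.

Definition hermitian n (M : 'M[R]_n) := forall i j, sigma (M i j) = M j i.

Local Notation dvd1 := (divisible1 rho).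
Local Notation dvd2 := (divisible2 rho quo).

(** What a diagonal unitary conjugation preserves. Principal minors are recorded instead of the
    conjugating matrix, and [Q] only off the diagonal, where it will mean being affine without
    determined variables. *)
Definition similar n (M M' : 'M[R]_n) := [/\ hermitian M',
  forall i, M' i i = M i i, forall i j, i != j -> Q (M i j) -> Q (M' i j) &
  forall k (phi : 'I_k -> 'I_n), \det (mxsub phi phi M') = \det (mxsub phi phi M)].

(** Conjugation by the diagonal matrix with entry [sigma pi / pi] on [U] and 1 elsewhere. This entry
    times its conjugate is 1, so the result is Hermitian. The entries leaving [U] can be divided by
    [pi] and still keep one factor [pi]; those entering [U] gain a factor [pi] and lose a factor
    [sigma pi]. *)
Lemma conjugation_step n (M : 'M[R]_n) (U : {set 'I_n}) : hermitian M ->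
  (forall i j, i \in U -> j \notin U -> dvd2 (M i j)) ->
  exists M', [/\ similar M M',
    forall i j, (i \in U) = (j \in U) -> M' i j = M i j &
    forall i j, (i \in U) != (j \in U) -> dvd1 (M' i j)].
Proof.
move=> Mh MU.
have ME i j : i \in U -> j \notin U -> M i j = pi * quo (M i j).
  by move=> iU jU; apply: rho0; apply/eqP; case/andP: (MU i j iU jU).
pose M' := \matrix_(i, j)
  (if (i \in U) && (j \notin U) then sigma pi * quo (M i j)
   else if (i \notin U) && (j \in U) then pi * sigma (quo (M j i)) else M i j).
(* The conjugating matrix, scaled by [pi] to avoid fractions. *)
pose E i := if i \in U then sigma pi else pi.
have E_neq0 i : E i != 0 by rewrite /E; case: ifP.
have M'E i j : M' i j * E j = E i * M i j.
  rewrite mxE /E; case: (boolP (i \in U)) => iU; case: (boolP (j \in U)) => jU /=.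
  - by rewrite mulrC.
  - by rewrite -mulrA [quo _ * _]mulrC -ME.
  - rewrite -mulrA [sigma _ * _]mulrC -rmorphM -(ME j i) //.
    by rewrite Mh.
  - by rewrite mulrC.
exists M'; split=> [|i j ijU|i j].
- split.
  + move=> i j; rewrite !mxE; case: (boolP (i \in U)); case: (boolP (j \in U)) => //= _ _.
      by rewrite rmorphM sigmaK.
    by rewrite rmorphM sigmaK.
  + by move=> i; rewrite mxE; case: (i \in U).
  + move=> i j _ Qij; rewrite mxE.
    case: (boolP (i \in U)) => iU; case: (boolP (j \in U)) => jU //=.
      by apply: Q_sigma_pi; apply/Q_pi; rewrite -ME.
    by apply/Q_pi/Q_sigma/Q_pi; rewrite -ME // -Mh; apply: Q_sigma.
  + move=> k phi; pose e := \row_i E (phi i).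
    have : mxsub phi phi M' *m diag_mx e = diag_mx e *m mxsub phi phi M.
      by apply/matrixP => i j; rewrite mul_mx_diag mul_diag_mx !mxE -M'E mxE.
    move/(congr1 determinant); rewrite !det_mulmx mulrC; apply: mulfI.
    by rewrite det_diag; apply/prodf_neq0 => i _; rewrite mxE.
- by rewrite mxE ijU andbN andNb.
rewrite mxE /divisible1.
case: (boolP (i \in U)) => iU; case: (boolP (j \in U)) => jU //= _.
  by case/andP: (MU i j iU jU) => _ /eqP d2; rewrite rmorphM d2 mulr0.
by rewrite rmorphM rho_pi mul0r.
Qed.

(** Induction on the number of entries not divisible by [pi]. From such an entry [(i0, j0)], let [U]
    be the set of vertices reachable from [j0] along entries not divisible by the square of [pi].
    Conjugating along [U] makes the entry divisible by [pi] and spoils no other one. *)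
Lemma balance n (M : 'M[R]_n) : hermitian M ->
  (forall k (phi : 'I_k.+1 -> 'I_n), injective phi ->
     exists G, \det (mxsub phi phi M) = pi ^+ k.+1 * G) ->
  exists M', similar M M' /\ forall i j, dvd1 (M' i j).
Proof.
pose bad (M : 'M[R]_n) := [set ij | ~~ dvd1 (M ij.1 ij.2)].
have [N] := ubnP #|bad M|; elim: N M => // N IHN M; rewrite ltnS => le_bad Mh minors.
have [bad0|[[i0 j0]]] := set_0Vmem (bad M).
  exists M; split; first by split.
  by move=> i j; have := in_set0 (i, j); rewrite -bad0 inE => /negbFE.
rewrite inE /= => bad_ij.
pose e i j := ~~ dvd2 (M i j); pose U := [set i | connect e j0 i].
(* A path from [j0] to [i0] would be closed by the entry [(i0, j0)], which would then be divisible
   by [pi]. *)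
have i0U : i0 \notin U.
  apply: contra bad_ij; rewrite inE => /connectP[p p_path ->].
  pose c a := nth j0 (j0 :: p) a.
  have -> : last j0 p = c (size p) by rewrite /c nth_last.
  apply: (cycle_divisible pi_neq0 rho_pi rho0 minors (c := c)).
  by move: p_path => /(pathP j0) p_path a /p_path.
have j0U : j0 \in U by rewrite inE connect0.
have MU i j : i \in U -> j \notin U -> dvd2 (M i j).
  rewrite !inE => j0i; apply: contraR => eij.
  exact: connect_trans j0i (connect1 eij).
have [M' [[M'h M'diag M'Q M'det] M'in M'out]] := conjugation_step Mh MU.
have [||k phi phi_inj|M'' [[M''h M''diag M''Q M''det] M''dvd]] := IHN M'.
- apply: leq_trans le_bad; apply/proper_card/properP; split.
    apply/subsetP => -[i j]; rewrite !inE /=.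
    have [ijU|/M'out->//] := eqVneq (i \in U) (j \in U).
    by rewrite M'in.
  exists (i0, j0); rewrite !inE //= negbK M'out //.
  by rewrite (negPf i0U) j0U.
- exact: M'h.
- by have [G GE] := minors k phi phi_inj; exists G; rewrite M'det.
exists M''; split=> //; split=> // [i|i j ij Qij|k phi].
- by rewrite M''diag.
- exact/M''Q/M'Q.
- by rewrite M''det.
Qed.
End Balancing.

(** * Descent to polynomial entries *)

Lemma monic_irreducible_factor (L : fieldType) (r : {poly L}) : (1 < size r)%N ->
  exists2 p, monic_irreducible_poly p & p %| r.
Proof.
elim/ltn_ind: {r}(size r) {-2}r (erefl (size r)) => N IHN r rN r_gt1.
(* Reducibility is not decidable over an arbitrary field, hence the excluded middle. *)
have [[q [q_gt1 lt_qr q_dvd]]|irr] :=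
  Classical_Prop.classic (exists q : {poly L}, [/\ (1 < size q)%N, (size q < size r)%N & q %| r]).
  have [|p p_irr p_dvd] := IHN (size q) _ q erefl q_gt1; first by rewrite -rN.
  by exists p => //; apply: dvdp_trans p_dvd q_dvd.
have r_neq0 : r != 0 by rewrite -size_poly_gt0 ltnW // rN.
have lc_neq0 : (lead_coef r)^-1 != 0 by rewrite invr_eq0 lead_coef_eq0.
exists ((lead_coef r)^-1 *: r); last by rewrite dvdpZl.
split; last by rewrite monicE lead_coefZ mulVf // lead_coef_eq0.
split=> [|q q_neq1]; first by rewrite size_scale // rN.
move=> q_dvdZ; rewrite -(dvdp_size_eqp q_dvdZ) size_scale //.
have q_dvd : q %| r by rewrite -(dvdpZr _ _ lc_neq0).
rewrite eqn_leq dvdp_leq //= leqNgt; apply/negP => lt_qr.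
apply: irr; exists q; split=> //; rewrite ltn_neqAle eq_sym q_neq1 size_poly_gt0.
by apply: contraNneq r_neq0 => q0; move: q_dvd; rewrite q0 dvd0p.
Qed.

Section ResidueField.
Variables (L : fieldType) (p : {poly L}) (p_irr : monic_irreducible_poly p).

Definition residue : {poly L} -> {poly %/ p with p_irr} := in_qpoly p.
HB.instance Definition _ := GRing.RMorphism.copy residue (in_qpoly p).

Lemma residue_eq0 x : (residue x == 0) = (p %| x).
Proof.
rewrite -(inj_eq val_inj) /= (mk_monicE p_irr) /dvdp.
by rewrite Pdiv.IdomainMonic.modpE //; case: p_irr.
Qed.
End ResidueField.

Section Content.
Variables (L : fieldType) (m : nat).
Implicit Types (e : {poly L}) (x : {mpoly {poly L}[m]}).

Definition mquo e x : {mpoly {poly L}[m]} :=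
  \sum_(v <- msupp x) (x@_v %/ e) *: 'X_[v].

Lemma mquoK e x : (forall v, e %| x@_v) -> x = e%:MP * mquo e x.
Proof.
move=> e_dvd; rewrite /mquo mulr_sumr {1}[x]mpolyE; apply: eq_bigr => v _.
by rewrite mul_mpolyC scalerA mulrC divpK.
Qed.

Lemma map_residue_eq0 p (p_irr : monic_irreducible_poly p) x :
  map_mpoly (residue p_irr) x = 0 <-> forall v, p %| x@_v.
Proof.
split=> [x0 v|p_dvd]; first by rewrite -(residue_eq0 p_irr) -mcoeff_map_mpoly x0 mcoeff0.
by apply/mpolyP => v; rewrite mcoeff_map_mpoly mcoeff0; apply/eqP; rewrite residue_eq0.
Qed.
End Content.

(** * Pencils and their principal minors *)

Section PencilDefs.
Variables (R : nzRingType) (m n : nat) (x : 'I_n -> 'I_m).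

Definition pencil (c : R) (b : 'M[{mpoly R[m]}]_n) :=
  diag_mx (\row_i (c *: 'X_(x i))) + b.

Definition affine_off (g : {mpoly R[m]}) :=
  forall v, v \in msupp g -> (mdeg v <= 1)%N /\ forall i, v (x i) = 0%N.

Definition derivs (s : seq 'I_n) (F : {mpoly R[m]}) :=
  foldr (fun i g => mderiv (x i) g) F s.
End PencilDefs.

Section Pencils.
Variables (R : idomainType) (m n : nat) (x : 'I_n -> 'I_m).
Hypothesis x_inj : injective x.

Lemma mderiv_derivation i : derivation (@mderiv m R i).
Proof. by split=> g h; [rewrite mderivD | rewrite mderivM]. Qed.

Lemma mderiv_affine_off (g : {mpoly R[m]}) i : affine_off x g -> mderiv (x i) g = 0.
Proof.
move=> g_aff; apply/mpolyP => v; rewrite mcoeff_mderiv mcoeff0.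
suff /memN_msupp_eq0->: (v + U_(x i))%MM \notin msupp g by rewrite mul0rn.
by apply/negP => /g_aff[_ /(_ i)]; rewrite mnmDE mnm1E eqxx addn1.
Qed.

Lemma mderiv_pencil c (b : 'M[{mpoly R[m]}]_n) k i j : (forall i j, affine_off x (b i j)) ->
  mderiv (x k) (pencil x c b i j) = c%:MP *+ ((i == k) && (j == k)).
Proof.
move=> b_aff; rewrite !mxE mderivD [mderiv _ (b i j)]mderiv_affine_off // addr0.
rewrite mderivMn mderivZ mderivX mnm1E (inj_eq x_inj).
have [->|ij] := eqVneq i j; last first.
  rewrite mulr0n; case: eqP => //= ik; case: eqP => // jk.
  by rewrite ik jk eqxx in ij.
rewrite andbb; have [->|_] := eqVneq j k; last by rewrite scale0r scaler0.
rewrite scale1r (_ : (U_(x k) - U_(x k))%MM = 0%MM) ?mpolyX0 ?alg_mpolyC //.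
by apply/mnmP => l; rewrite mnmBE subnn mnm0E.
Qed.

Lemma derivsC s c (F : {mpoly R[m]}) : derivs x s (c%:MP * F) = c%:MP * derivs x s F.
Proof. by elim: s => //= i s ->; rewrite mderiv_mulC. Qed.

(** The [n - k] derivations that isolate the minor produce the factor [c ^+ (n - k)], which cancels
    against [c ^+ n]. The minors of order [k] are thus controlled by derivatives of [F]. *)
Lemma pencil_minors (u c : R) (b : 'M[{mpoly R[m]}]_n) F : c != 0 -> (forall i j, affine_off x (b i j)) ->
  u%:MP * \det (pencil x c b) = c%:MP ^+ n * F ->
  forall k (phi : 'I_k -> 'I_n), injective phi ->
  exists s, (size s + k = n)%N /\
    u%:MP * \det (mxsub phi phi (pencil x c b)) = c%:MP ^+ k * derivs x s F.
Proof.
move=> c_neq0 b_aff detE k phi phi_inj.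
have [|||s [s_size sE]] :=
    @minor_deriv _ c%:MP n (fun i => mderiv (x i)) (pencil x c b) k phi _ _ _ phi_inj.
- by move=> i; apply: mderiv_derivation.
- by move=> i; rewrite mderivC.
- by move=> i a a'; rewrite mderiv_pencil.
exists s; split=> //.
have /mulfI : (c%:MP ^+ size s : {mpoly R[m]}) != 0.
  by rewrite expf_neq0 // mpolyC_eq0.
apply; rewrite mulrCA -sE -[foldr _ _ _]/(derivs x s _) -derivsC detE mulrA -exprD s_size.
by rewrite -rmorphXn derivsC.
Qed.
End Pencils.

Lemma pencilE (R : nzRingType) m n (x : 'I_n -> 'I_m) (c : R)
    (b : 'M[{mpoly R[m]}]_n) i j :
  pencil x c b i j = c *: 'X_(x i) *+ (i == j) + b i j.
Proof. by rewrite !mxE. Qed.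

Lemma affine_offC (R : nzRingType) m n (x : 'I_n -> 'I_m) (c : R) : affine_off x (c%:MP_[m]).
Proof.
move=> v; rewrite msuppC; case: eqP => // _; rewrite inE => /eqP->.
by rewrite mdeg0; split=> // i; rewrite mnm0E.
Qed.

Lemma map_poly_involutive (R : nzRingType) (f : {rmorphism R -> R}) :
  involutive f -> involutive (map_poly f).
Proof. by move=> fK p; apply/polyP => k; rewrite !coef_map /= fK. Qed.

Lemma map_mpoly_involutive (R : nzRingType) m (f : {rmorphism R -> R}) :
  involutive f -> involutive (@map_mpoly m R R f).
Proof. by move=> fK g; apply/mpolyP => v; rewrite !mcoeff_map_mpoly /= fK. Qed.

Lemma map_mpoly_inj (R S : nzRingType) (f : {rmorphism R -> S}) m :
  injective f -> injective (@map_mpoly m R S f).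
Proof.
by move=> f_inj p q pq; apply/mpolyP => v; apply: f_inj; rewrite -!mcoeff_map_mpoly pq.
Qed.

Lemma affine_offZ (R : idomainType) m n (x : 'I_n -> 'I_m) c (g : {mpoly R[m]}) :
  c != 0 -> affine_off x (c%:MP * g) <-> affine_off x g.
Proof.
move=> c0; rewrite mul_mpolyC.
by split=> g_aff v v_in; apply: g_aff; move: v_in; rewrite (perm_mem (msuppZ g c0)).
Qed.

Lemma affine_off_map (R S : nzRingType) (f : {rmorphism R -> S}) m n (x : 'I_n -> 'I_m)
  (g : {mpoly R[m]}) : affine_off x g -> affine_off x (map_mpoly f g).
Proof.
move=> g_aff v; rewrite mcoeff_msupp mcoeff_map_mpoly => fv; apply: g_aff.
by rewrite mcoeff_msupp; apply: contraNneq fv => -> /=; rewrite rmorph0.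
Qed.

Section Descent.
Variables (L : fieldType) (conj : {rmorphism L -> L}) (conjK : involutive conj).
Variables (m n : nat) (x : 'I_n -> 'I_m) (x_inj : injective x).
Local Notation P := {mpoly {poly L}[m]}.
Local Notation cP := (map_poly conj).
Local Notation cM := (map_mpoly (map_poly conj)).
Variables (u : {poly L}) (F : P).
Hypothesis u_neq0 : u != 0.

Definition representation (r : {poly L}) (b : 'M[P]_n) :=
  [/\ hermitian cM b, forall i j, affine_off x (b i j) &
      u%:MP * \det (pencil x (u * r) b) = (u * r)%:MP ^+ n * F].

Lemma representation_div (e r : {poly L}) (b : 'M[P]_n) : e != 0 -> cP e = e ->
  (forall i j v, e %| (b i j)@_v) -> representation (e * r) b ->
  exists b', representation r b'.
Proof.
move=> e_neq0 e_real e_dvd [b_herm b_aff detb].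
have eC_neq0 : e%:MP_[m] != 0 by rewrite mpolyC_eq0.
pose b' : 'M[P]_n := \matrix_(i, j) mquo e (b i j).
have bE i j : b i j = e%:MP * b' i j by rewrite mxE -mquoK.
clearbody b'; exists b'; split=> [i j|i j|].
- apply: (mulfI eC_neq0); rewrite -bE -b_herm bE rmorphM.
  by rewrite /= map_mpolyC /= e_real.
- by apply/(affine_offZ _ _ e_neq0); rewrite -bE.
have /mulfI : e%:MP_[m] ^+ n != 0 by rewrite expf_neq0.
apply; rewrite mulrCA -detZ.
have -> : e%:MP *: pencil x (u * r) b' = pencil x (u * (e * r)) b.
  apply/matrixP => i j; rewrite !mxE mulrDr -bE.
  by rewrite mulrnAr mul_mpolyC scalerA mulrCA.
by rewrite detb mulrCA mpolyCM exprMn mulrA.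
Qed.

(** Induction on the degree of [r]. Balancing at an irreducible factor [p] of [r] makes all entries
    divisible by [p], hence by Hermitian symmetry also by its conjugate. A factor of [r] fixed by
    the conjugation can then be divided out. *)
Lemma descent (r : {poly L}) (b : 'M[P]_n) : r != 0 -> cP u = u -> cP r = r -> representation r b ->
  exists b', representation 1 b'.
Proof.
move=> + u_real; elim/ltn_ind: {r}(size r) {-2}r (erefl (size r)) b => N IHN r rN b.
move=> r_neq0 r_real rep_b.
have [r_le1|r_gt1] := leqP (size r) 1.
  rewrite -[r]mulr1 in rep_b; apply: (representation_div r_neq0 r_real _ rep_b).
  move=> i j v; rewrite (eqp_dvdl _ (_ : r %= 1)) ?dvd1p //.
  by rewrite -size_poly_eq1 eqn_leq r_le1 size_poly_gt0.
have [p p_irr /dvdpP[r1 rE]] := monic_irreducible_factor r_gt1.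
have [[p_gt1 p_min] p_monic] := p_irr.
have p_neq0 := monic_neq0 p_monic.
have pC_neq0 : p%:MP_[m] != 0 by rewrite mpolyC_eq0.
have [b_herm b_aff detb] := rep_b.
pose rho : {rmorphism P -> {mpoly {poly %/ p with p_irr}[m]}} :=
  map_mpoly (residue p_irr).
have rho_p : rho p%:MP = 0.
  by apply/map_residue_eq0 => v; rewrite mcoeffC dvdp_mulr.
have rho_quo y : rho y = 0 -> y = p%:MP * mquo p y.
  by move=> /map_residue_eq0; apply: mquoK.
have cMK := @map_mpoly_involutive _ m _ (map_poly_involutive conjK).
have Q_p y : affine_off x (p%:MP * y) <-> affine_off x y by apply: affine_offZ.
have Q_conj y : affine_off x y -> affine_off x (cM y) by apply: affine_off_map.
pose M := pencil x (u * r) b.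
have M_herm : hermitian cM M.
  move=> i j; rewrite !mxE rmorphD /= b_herm rmorphMn /= map_mpolyZ map_mpolyX.
  rewrite rmorphM /= u_real r_real eq_sym; congr (_ + _).
  by case: (eqVneq j i) => [->|].
have ur_neq0 : u * r != 0 by rewrite mulf_neq0.
(* One factor [u] is lost in [pencil_minors], but none of the factors [r], so [p] still divides to
   the full power [k.+1]. *)
have M_minors k (phi : 'I_k.+1 -> 'I_n) : injective phi ->
    exists G, \det (mxsub phi phi M) = p%:MP ^+ k.+1 * G.
  move=> phi_inj; have [s [_ sE]] := pencil_minors x_inj ur_neq0 b_aff detb phi_inj.
  exists ((u ^+ k * r1 ^+ k.+1)%:MP * derivs x s F).
  have /mulfI : u%:MP_[m] != 0 by rewrite mpolyC_eq0.
  have expC (c : {poly L}) l : c%:MP_[m] ^+ l = (c ^+ l)%:MP by rewrite rmorphXn.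
  apply; rewrite sE !mulrA !expC -!mpolyCM; congr (_%:MP * _).
  by rewrite rE !exprMn (exprS u) [RHS]mulrACA; congr (_ * _); rewrite mulrC.
have [M' [[M'_herm M'_diag M'_aff M'_det] M'_dvd]] :=
  balance pC_neq0 rho_p rho_quo cMK Q_p Q_conj M_herm M_minors.
pose b' := M' - diag_mx (\row_i ((u * r) *: 'X_(x i))).
have M'E : M' = pencil x (u * r) b' by rewrite /pencil /b' addrC subrK.
have b'_off i j : i != j -> b' i j = M' i j.
  by move=> ij; rewrite !mxE (negPf ij) mulr0n subr0.
have b'_diag i : b' i i = b i i.
  by rewrite !mxE eqxx mulr1n M'_diag !mxE eqxx mulr1n addrC addKr.
have rep_b' : representation r b'.
  split=> [i j|i j|].
  - have [->|ij] := eqVneq i j; first by rewrite b'_diag b_herm.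
    by rewrite !b'_off // eq_sym.
  - have [->|ij] := eqVneq i j; first by rewrite b'_diag.
    rewrite b'_off //; apply: M'_aff => //.
    by rewrite /M !mxE (negPf ij) mulr0n add0r.
  rewrite -M'E -detb; congr (_ * _); have := M'_det n id.
  by rewrite !mxsub_id.
have p_dvd i j v : p %| (b' i j)@_v.
  rewrite !mxE mcoeffB dvdp_sub //; last first.
    rewrite mcoeffMn mcoeffZ -mulr_natr; apply/dvdp_mulr/dvdp_mulr.
    by rewrite rE mulrA dvdp_mull.
  by move: v; apply/(map_residue_eq0 p_irr)/eqP/M'_dvd.
have [b'_herm b'_aff detb'] := rep_b'.
have cp_dvd i j v : cP p %| (b' i j)@_v.
  by rewrite -b'_herm mcoeff_map_mpoly /= dvdp_map.
have finish e : e %| r -> (1 < size e)%N -> cP e = e ->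
    (forall i j v, e %| (b' i j)@_v) -> exists b', representation 1 b'.
  move=> /dvdpP[r2 r2E] e_gt1 e_real e_dvd.
  have e_neq0 : e != 0 by rewrite -size_poly_gt0 ltnW.
  have r2_neq0 : r2 != 0 by apply: contraNneq r_neq0 => r20; rewrite r2E r20 mul0r.
  have rep2 : representation (e * r2) b' by rewrite mulrC -r2E.
  have [b'' rep_b''] := representation_div e_neq0 e_real e_dvd rep2.
  apply: (IHN (size r2)) rep_b'' => //.
    rewrite -rN r2E size_mul //; case: (size e) e_gt1 => [|[|k]] // _.
    by rewrite !addnS ltnS leq_addr.
  by apply: (mulIf e_neq0); rewrite -[in LHS]e_real -rmorphM /= -r2E r_real.
have p_dvd_r : p %| r by rewrite rE dvdp_mull.
have [p_real|p_nreal] := eqVneq (cP p) p; first exact: (finish p).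
(* Two distinct monic irreducible polynomials of equal degree are coprime, so the product of [p] and
   its conjugate divides [r] and all entries. *)
have p_coprime : coprimep p (cP p).
  rewrite irreducible_poly_coprime //; apply: contra p_nreal => p_dvd_cp.
  rewrite -eqp_monic ?monic_map // eqp_sym -dvdp_size_eqp //.
  by rewrite size_map_poly.
apply: (finish (p * cP p)).
- by rewrite Gauss_dvdp // p_dvd_r -r_real dvdp_map.
- rewrite size_mul ?map_poly_eq0 // size_map_poly.
  by case: (size p) p_gt1 => [|[|k]] // _; rewrite addnS.
- by rewrite rmorphM /= map_poly_involutive // mulrC.
- by move=> i j v; rewrite Gauss_dvdp // p_dvd cp_dvd.
Qed.
End Descent.

(** * Fractions *)

Section FractionMap.
Local Open Scope quotient_scope.
Variables (R : idomainType) (f : {rmorphism R -> R}) (f_inj : injective f).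
Local Notation "x %:F" := (@FracField.tofrac R x).

Lemma fraction_numden (z : {fraction R}) :
  z = (\n_(repr z))%:F / (\d_(repr z))%:F.
Proof.
have d_neq0 : (\d_(repr z))%:F != 0 by rewrite tofrac_eq0 denom_ratioP.
apply: (mulIf d_neq0); rewrite divfK // -[z in LHS]reprK.
set r := repr z; unlock FracField.tofrac; rewrite -[LHS]FracField.pi_mul.
apply/eqmodP => /=; rewrite FracField.equivfE /FracField.mulf.
rewrite !numden_Ratio ?mulr1 ?oner_neq0 ?mulf_neq0 ?denom_ratioP ?oner_neq0 //.
by rewrite /r reprK mulrC.
Qed.

(** Computed on the chosen representative; [fraction_mapE] shows that any other one gives the same
    value, because an injective [f] keeps denominators nonzero. *)
Definition fraction_map (z : {fraction R}) : {fraction R} :=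
  (f \n_(repr z))%:F / (f \d_(repr z))%:F.

Let f_neq0 a : a != 0 -> (f a)%:F != 0.
Proof. by move=> a0; rewrite tofrac_eq0 -(rmorph0 f) (inj_eq f_inj). Qed.

Lemma fraction_mapE a b : b != 0 -> fraction_map (a%:F / b%:F) = (f a)%:F / (f b)%:F.
Proof.
move=> b_neq0; rewrite /fraction_map; set z := a%:F / b%:F.
have d_neq0 := denom_ratioP (repr z).
apply/eqP; rewrite eqr_div ?f_neq0 // -!tofracM -!rmorphM tofrac_eq (inj_eq f_inj).
have /eqP := fraction_numden z; rewrite {1}/z eqr_div ?tofrac_eq0 //.
by rewrite -!tofracM tofrac_eq eq_sym.
Qed.

Lemma fraction_map_tofrac a : fraction_map a%:F = (f a)%:F.
Proof. by rewrite -[a%:F]divr1 -tofrac1 fraction_mapE ?oner_eq0 // rmorph1 divr1. Qed.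

Lemma fractionP (z : {fraction R}) : exists a b, b != 0 /\ z = a%:F / b%:F.
Proof.
by exists \n_(repr z), \d_(repr z); rewrite denom_ratioP -fraction_numden.
Qed.

Lemma fraction_map_is_zmod_morphism : zmod_morphism fraction_map.
Proof.
move=> y z; have [a [b [b0 ->]]] := fractionP y; have [c [d [d0 ->]]] := fractionP z.
have subE (a1 b1 c1 d1 : R) : b1%:F != 0 -> d1%:F != 0 ->
    a1%:F / b1%:F - c1%:F / d1%:F = (a1 * d1 - c1 * b1)%:F / (b1 * d1)%:F.
  by move=> b1n d1n; rewrite -mulNr addf_div // mulNr tofracB !tofracM.
rewrite !fraction_mapE // !subE ?f_neq0 ?tofrac_eq0 //.
by rewrite fraction_mapE ?mulf_neq0 // !(rmorphB, rmorphM).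
Qed.

Lemma fraction_map_is_monoid_morphism : monoid_morphism fraction_map.
Proof.
split=> [|y z]; first by rewrite -tofrac1 fraction_map_tofrac rmorph1.
have [a [b [b0 ->]]] := fractionP y; have [c [d [d0 ->]]] := fractionP z.
have mulE (a1 b1 c1 d1 : R) :
    (a1%:F / b1%:F) * (c1%:F / d1%:F) = (a1 * c1)%:F / (b1 * d1)%:F.
  by rewrite mulf_div !tofracM.
by rewrite !fraction_mapE // !mulE fraction_mapE ?mulf_neq0 // !rmorphM.
Qed.

Hypothesis fK : involutive f.

Lemma fraction_map_involutive : involutive fraction_map.
Proof.
move=> z; have [c [d [d0 ->]]] := fractionP z.
have fd0 : f d != 0 by rewrite -tofrac_eq0 f_neq0.
by rewrite !fraction_mapE // !fK.
Qed.
End FractionMap.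

Section FractionConj.
Variables (R : idomainType) (f : involutive_rmorphism R).

Definition fraction_conj := fraction_map f.

HB.instance Definition _ := GRing.isZmodMorphism.Build _ _ fraction_conj
  (fraction_map_is_zmod_morphism (inv_inj (rmorphK f))).
HB.instance Definition _ := GRing.isMonoidMorphism.Build _ _ fraction_conj
  (fraction_map_is_monoid_morphism (inv_inj (rmorphK f))).
HB.instance Definition _ := isInvolutive.Build _ fraction_conj
  (fraction_map_involutive (inv_inj (rmorphK f)) (rmorphK f)).

Lemma fraction_conj_tofrac a :
  fraction_conj (FracField.tofrac a) = FracField.tofrac (f a).
Proof. exact/fraction_map_tofrac/inv_inj/rmorphK. Qed.
End FractionConj.

Section PolyConj.
Variables (R : nzRingType) (f : involutive_rmorphism R).
Definition poly_conj : {poly R} -> {poly R} := map_poly f.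
HB.instance Definition _ := GRing.RMorphism.copy poly_conj (map_poly f).
HB.instance Definition _ := isInvolutive.Build _ poly_conj
  (map_poly_involutive (rmorphK f)).
End PolyConj.

Section ClearDenominators.
Variables (R : idomainType) (m : nat).
Local Notation tofrac := (@FracField.tofrac R).

Lemma clear_denominators1 (g : {mpoly {fraction R}[m]}) :
  exists d, exists2 g' : {mpoly R[m]}, d != 0 & map_mpoly tofrac g' = tofrac d *: g.
Proof.
elim/mpolyind: g => [|c v g _ _ [d [g' d0 g'E]]].
  by exists 1, 0; rewrite ?oner_eq0 // rmorph0 scaler0.
have [a [b [b0 ->]]] := fractionP c.
have bF0 : tofrac b != 0 by rewrite tofrac_eq0.
exists (b * d), ((a * d) *: 'X_[v] + b *: g'); first by rewrite mulf_neq0.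
rewrite rmorphD /= !map_mpolyZ map_mpolyX g'E scalerDr !scalerA -!tofracM.
congr (_ *: _ + _); by rewrite /= !tofracM [RHS]mulrC mulrA (divfK bF0).
Qed.

Lemma clear_denominators n (A : 'M[{mpoly {fraction R}[m]}]_n) :
  exists d, exists2 b : 'M[{mpoly R[m]}]_n, d != 0 &
    forall i j, map_mpoly tofrac (b i j) = tofrac d *: A i j.
Proof.
have [d dP] := fin_all_exists (fun ij : 'I_n * 'I_n => clear_denominators1 (A ij.1 ij.2)).
have [g g0 gE] := fin_all_exists2 dP.
exists (\prod_ij d ij), (\matrix_(i, j) ((\prod_(kl | kl != (i, j)) d kl) *: g (i, j))).
  exact/prodf_neq0.
move=> i j; rewrite mxE map_mpolyZ gE scalerA -tofracM.
by rewrite [in RHS](bigD1 (i, j)) //= mulrC.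
Qed.
End ClearDenominators.

(** * Splitting off the last variable *)

Lemma widen_ord_lift m j : widen_ord (leqnSn m) j = lift ord_max j.
Proof. by apply: val_inj; apply/esym/lift_max. Qed.

Section SplitLast.
Variables (R : comNzRingType) (m : nat).
Local Notation P := {mpoly {poly R}[m]}.

Definition mjoin (u : 'X_{1..m}) (k : nat) : 'X_{1..m.+1} :=
  [multinom (if unlift ord_max i is Some j then u j else k) | i < m.+1].

Definition mrestr (v : 'X_{1..m.+1}) : 'X_{1..m} :=
  [multinom v (lift ord_max j) | j < m].

Lemma mjoin_lift u k j : mjoin u k (lift ord_max j) = u j.
Proof. by rewrite mnmE liftK. Qed.

Lemma mjoin_max u k : mjoin u k ord_max = k.
Proof. by rewrite mnmE unlift_none. Qed.

Lemma mrestrK v : mjoin (mrestr v) (v ord_max) = v.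
Proof. by apply/mnmP => i; rewrite mnmE; case: unliftP => [j ->|->] //; rewrite mnmE. Qed.

Lemma mjoinK u k : mrestr (mjoin u k) = u.
Proof. by apply/mnmP => j; rewrite mnmE mjoin_lift. Qed.

Lemma eq_mjoin v u k : (v == mjoin u k) = (mrestr v == u) && (v ord_max == k).
Proof.
apply/eqP/andP => [->|[/eqP<- /eqP<-]]; first by rewrite mjoinK mjoin_max !eqxx.
by rewrite mrestrK.
Qed.

Lemma mjoinD u k j : mjoin (u + U_(j)) k = (mjoin u k + U_(lift ord_max j))%MM.
Proof.
apply/mnmP => i; rewrite mnmDE !mnmE; case: unliftP => [l ->|->].
  by rewrite mnmDE mnm1E (inj_eq (@lift_inj _ _)).
by rewrite [lift _ _ == _]eq_sym (negPf (neq_lift _ _)) addn0.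
Qed.

Lemma mdeg_mjoin u k : mdeg (mjoin u k) = (mdeg u + k)%N.
Proof.
rewrite !mdegE big_ord_recr /= mjoin_max; congr (_ + _)%N; apply: eq_bigr => j _.
by rewrite widen_ord_lift mjoin_lift.
Qed.

(* The isomorphism onto polynomials in all but the last variable, with
   coefficients that are polynomials in the last one. *)
Definition split_var (i : 'I_m.+1) : P :=
  if unlift ord_max i is Some j then 'X_j else ('X)%:MP.
Definition split_last : {mpoly R[m.+1]} -> P :=
  mmap (@mpolyC m {poly R} \o polyC) split_var.
HB.instance Definition _ := GRing.RMorphism.copy split_last
  (mmap (@mpolyC m {poly R} \o polyC) split_var).

Lemma split_lastE f :
  split_last f = \sum_(v <- msupp f) (f@_v *: 'X^(v ord_max)) *: 'X_[mrestr v].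
Proof.
rewrite /split_last /mmap; apply: eq_bigr => v _ /=.
rewrite -mul_polyC -scalerA -mul_mpolyC; congr (_ * _).
rewrite /mmap1 big_ord_recr /= /split_var unlift_none -rmorphXn mulrC -mul_mpolyC; congr (_ * _).
rewrite mpolyXE_id; apply: eq_bigr => j _.
by rewrite widen_ord_lift liftK mnmE.
Qed.

(** Injectivity of [split_last] and its compatibility with derivatives and conjugation all reduce to
    this comparison of coefficients. *)
Lemma coef_split_last f u k : (split_last f)@_u`_k = f@_(mjoin u k).
Proof.
rewrite split_lastE [in RHS](mpolyE f) !raddf_sum coef_sum.
apply: eq_bigr => v _; rewrite /= !mcoeffZ !mcoeffX eq_mjoin -mulr_natr.
by case: eqP => _; rewrite /= ?mulr1 ?mulr0 ?coefZ ?coefXn ?coef0 // eq_sym.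
Qed.

Lemma split_last_inj : injective split_last.
Proof.
move=> f g fg; apply/mpolyP => v.
by rewrite -[v]mrestrK -!coef_split_last fg.
Qed.

Lemma split_lastC c : split_last c%:MP = c%:P%:MP.
Proof. exact: mmapC. Qed.

Lemma split_lastZ c f : split_last (c *: f) = c%:P *: split_last f.
Proof. by rewrite -[c *: f]mul_mpolyC rmorphM /= split_lastC mul_mpolyC. Qed.

Lemma split_last_lift j : split_last 'X_(lift ord_max j) = 'X_j.
Proof. by rewrite /split_last mmapX mmap1U /split_var liftK. Qed.

Lemma split_last_max : split_last 'X_ord_max = ('X)%:MP.
Proof. by rewrite /split_last mmapX mmap1U /split_var unlift_none. Qed.

Lemma split_last_surj g : exists f, split_last f = g.
Proof.
exists (\sum_(u <- msupp g) \sum_(k < size g@_u) g@_u`_k *: 'X_[mjoin u k]).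
rewrite rmorph_sum [RHS]mpolyE; apply: eq_bigr => u _.
rewrite rmorph_sum -[in RHS](coefK g@_u) poly_def scaler_suml; apply: eq_bigr => k _.
rewrite /= split_lastZ -[in RHS]mul_polyC -scalerA; congr (_ *: _).
rewrite /split_last mmapX /mmap1 big_ord_recr /= /split_var unlift_none mjoin_max.
rewrite mulrC -rmorphXn mul_mpolyC mpolyXE_id; congr (_ *: _).
apply: eq_bigr => j _.
by rewrite widen_ord_lift liftK mjoin_lift.
Qed.

Lemma split_last_deriv j f :
  mderiv j (split_last f) = split_last (mderiv (lift ord_max j) f).
Proof.
apply/mpolyP => u; apply/polyP => k.
by rewrite mcoeff_mderiv coefMn !coef_split_last mcoeff_mderiv mjoinD mjoin_lift.
Qed.

Lemma split_last_map (f : {rmorphism R -> R}) g :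
  split_last (map_mpoly f g) = map_mpoly (map_poly f) (split_last g).
Proof.
apply/mpolyP => u; apply/polyP => k.
by rewrite mcoeff_map_mpoly coef_map /= !coef_split_last mcoeff_map_mpoly.
Qed.

Lemma msupp_split_last f u : u \in msupp (split_last f) ->
  exists k, mjoin u k \in msupp f.
Proof.
rewrite mcoeff_msupp => fu; exists (size (split_last f)@_u).-1.
by rewrite mcoeff_msupp -coef_split_last -lead_coefE lead_coef_eq0.
Qed.
End SplitLast.

(** * Rayleigh differences of derivatives *)

Section Taylor.
Variables (R : comNzRingType) (m : nat) (k : 'I_m).
Local Notation P := {mpoly R[m]}.

Definition taylor_var (l : 'I_m) : {poly P} := ('X_l)%:P + 'X *+ (l == k).
(* [f(x_k + T)], as a polynomial in [T]. *)
Definition taylor : P -> {poly P} := mmap (polyC \o @mpolyC m R) taylor_var.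
HB.instance Definition _ :=
  GRing.RMorphism.copy taylor (mmap (polyC \o @mpolyC m R) taylor_var).

Definition multiaffine_in (f : P) := forall v, v \in msupp f -> (v k <= 1)%N.

Lemma mmap1_taylor (v : 'X_{1..m}) :
  taylor 'X_[v] = (\prod_(l | l != k) 'X_l ^+ v l)%:P * (('X_k)%:P + 'X) ^+ v k.
Proof.
rewrite /taylor mmapX /mmap1 (bigD1 k) //= mulrC; congr (_ * _); last first.
  by rewrite /taylor_var eqxx.
rewrite rmorph_prod; apply: eq_bigr => l lk.
by rewrite /taylor_var (negPf lk) mulr0n addr0 rmorphXn.
Qed.

Lemma taylorZ c f : taylor (c *: f) = (c%:MP)%:P * taylor f.
Proof. by rewrite -[c *: f]mul_mpolyC rmorphM /= [taylor _%:MP]mmapC. Qed.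

Lemma taylor_multiaffine f : multiaffine_in f ->
  taylor f = f%:P + (mderiv k f)%:P * 'X.
Proof.
move=> f_aff; pose A (g : P) := g%:P + (mderiv k g)%:P * 'X.
have A0 : A 0 = 0 by rewrite /A mderiv0 polyC0 mul0r addr0.
have AD g h : A (g + h) = A g + A h.
  by rewrite /A mderivD !rmorphD mulrDl addrACA.
rewrite -/(A f) [f]mpolyE rmorph_sum (big_morph A AD A0).
apply: eq_big_seq => v /f_aff vk; rewrite /A /=.
rewrite taylorZ mderivZ -!mul_mpolyC !rmorphM -mulrA -mulrDr; congr (_ * _).
rewrite mmap1_taylor mderivX [in RHS]mpolyXE_id [in RHS](bigD1 k) //=.
move: vk; case vkE: (v k) => [|[|//]] _.
  by rewrite scale0r polyC0 !expr0 mul0r addr0 mulr1 mul1r.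
rewrite scale1r !expr1 mulrDr rmorphM /= mulrC; congr (_ + _%:P * _).
rewrite mpolyXE_id [in RHS](bigD1 k) //= mnmBE mnm1E eqxx vkE expr0 mul1r.
by apply: eq_bigr => l lk; rewrite mnmBE mnm1E eq_sym (negPf lk) subn0.
Qed.

Lemma multiaffine_in_deriv i f : multiaffine_in f -> multiaffine_in (mderiv i f).
Proof.
move=> f_aff v; rewrite mcoeff_msupp mcoeff_mderiv => fv.
have /f_aff : (v + U_(i))%MM \in msupp f.
  by rewrite mcoeff_msupp; apply: contraNneq fv => ->; rewrite mul0rn.
by rewrite mnmDE; apply: leq_trans; apply: leq_addr.
Qed.

Lemma taylor_map (sigma : {rmorphism R -> R}) f :
  taylor (map_mpoly sigma f) = map_poly (map_mpoly sigma) (taylor f).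
Proof.
elim/mpolyind: f => [|c v f _ _ IHf]; first by rewrite !rmorph0.
rewrite !rmorphD /= IHf; congr (_ + _).
rewrite map_mpolyZ map_mpolyX !taylorZ rmorphM /= map_polyC /= map_mpolyC.
congr (_ * _); rewrite mmap1_taylor rmorphM rmorphXn rmorphD /= map_polyX !map_polyC /=.
rewrite map_mpolyX [in RHS]rmorph_prod; congr (_%:P * _); apply: eq_bigr => l _.
by rewrite rmorphXn /= map_mpolyX.
Qed.
End Taylor.

Lemma coef2M (R : nzRingType) (p q : {poly R}) :
  (size p <= 2)%N -> (size q <= 2)%N -> (p * q)`_2 = p`_1 * q`_1.
Proof.
move=> p2 q2; rewrite coefM !big_ord_recl big_ord0 /= /bump /=.
by rewrite [q`_2]nth_default // [p`_2]nth_default // mulr0 mul0r add0r !addr0.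
Qed.

Lemma size_taylor_multiaffine (R : comNzRingType) m (k : 'I_m) (f : {mpoly R[m]}) :
  multiaffine_in k f -> (size (taylor k f) <= 2)%N.
Proof.
move=> /taylor_multiaffine->; rewrite addrC.
by rewrite -cons_poly_def size_cons_poly; case: ifP => // _; rewrite ltnS size_polyC leq_b1.
Qed.

Lemma coef1_taylor (R : comNzRingType) m (k : 'I_m) (f : {mpoly R[m]}) :
  multiaffine_in k f -> (taylor k f)`_1 = mderiv k f.
Proof. by move=> /taylor_multiaffine->; rewrite coefD coefC coefMX coefC add0r. Qed.

Lemma size2M (R : nzRingType) (p q : {poly R}) :
  (size p <= 2)%N -> (size q <= 2)%N -> (size (p * q)%R <= 3)%N.
Proof.
move=> p2 q2; apply: leq_trans (size_polyMleq _ _) _.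
by have := leq_add p2 q2; case: (size p + size q)%N.
Qed.

(** An injective [sigma] preserves degrees, so the product has twice the degree of [p]. *)
Lemma size_hermitian_square (R : idomainType) (sigma : {rmorphism R -> R}) (p : {poly R}) :
  injective sigma -> (size (p * map_poly sigma p)%R <= 3)%N -> (size p <= 2)%N.
Proof.
move=> sigma_inj; have size_conj : size (map_poly sigma p) = size p.
  by rewrite size_map_inj_poly ?rmorph0.
have [->|p_neq0] := eqVneq p 0; first by rewrite size_poly0.
have cp_neq0 : map_poly sigma p != 0 by rewrite -size_poly_gt0 size_conj size_poly_gt0.
rewrite size_mul // size_conj.
by case: (size p) => [|[|[|s]]] //; rewrite !addSn !addnS.
Qed.

Lemma coef2_hermitian_square (R : idomainType) (sigma : {rmorphism R -> R})
    (p r : {poly R}) :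
  injective sigma -> r = p * map_poly sigma p -> (size r <= 3)%N ->
  r`_2 = p`_1 * sigma p`_1.
Proof.
move=> sigma_inj -> /(size_hermitian_square sigma_inj) size_p.
by rewrite coef2M ?size_map_inj_poly ?rmorph0 // coef_map.
Qed.

(* The Rayleigh difference of [d f / d x_k] is the coefficient of [x_k ^ 2] in
   that of [f], and a Hermitian square of degree 2 in [x_k] is [g * gbar] with
   [g] of degree 1. *)
Lemma rayleigh_deriv (L : fieldType) (conj : {rmorphism L -> L}) m
    (i j k : 'I_m) (f g : {mpoly L[m]}) :
  multiaffine_in k f -> rayleigh i j f = g * map_mpoly conj g ->
  exists h, rayleigh i j (mderiv k f) = h * map_mpoly conj h.
Proof.
move=> f_aff fg; exists (taylor k g)`_1.
have fi_aff : multiaffine_in k (mderiv i f) by apply: multiaffine_in_deriv.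
have fj_aff : multiaffine_in k (mderiv j f) by apply: multiaffine_in_deriv.
have fij_aff : multiaffine_in k (mderiv i (mderiv j f)) by apply: multiaffine_in_deriv.
have s0 := size_taylor_multiaffine f_aff.
have si := size_taylor_multiaffine fi_aff.
have sj := size_taylor_multiaffine fj_aff.
have sij := size_taylor_multiaffine fij_aff.
have conj_inj := @map_mpoly_inj _ _ _ m (fmorph_inj conj).
have rayE : taylor k (rayleigh i j f) =
    taylor k (mderiv i f) * taylor k (mderiv j f) -
    taylor k f * taylor k (mderiv i (mderiv j f)).
  by apply: etrans (rmorphB _ _ _) _; congr (_ - _); apply: rmorphM.
(* All four factors have degree at most 1 in [T], so the coefficient of [T ^ 2] comes from their
   linear coefficients, which are the derivatives in [x_k]. *)
have size_ray : (size (taylor k (rayleigh i j f)) <= 3)%N.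
  rewrite rayE; apply: leq_trans (size_polyD _ _) _; rewrite size_polyN geq_max.
  by apply/andP; split; [apply: size2M si sj | apply: size2M s0 sij].
have fg_taylor :
    taylor k (rayleigh i j f) = taylor k g * map_poly (map_mpoly conj) (taylor k g).
  by apply: etrans (congr1 (taylor k) fg) _; rewrite -taylor_map; apply: rmorphM.
apply: etrans (coef2_hermitian_square conj_inj fg_taylor size_ray).
apply/esym; rewrite rayE coefB; congr (_ - _).
  rewrite (coef2M si sj); congr (_ * _).
    by rewrite (coef1_taylor fi_aff) mderiv_comm.
  by rewrite (coef1_taylor fj_aff) mderiv_comm.
rewrite (coef2M s0 sij); congr (_ * _); first exact: coef1_taylor f_aff.
by rewrite (coef1_taylor fij_aff) (mderiv_comm i k) (mderiv_comm j k).
Qed.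

(** * The induction step *)

(** The induction hypothesis ranges over all fields with an involution, because the step passes from
    [L] to the fraction field of [L[t]]. The coefficient matrices are packed into one matrix of
    affine entries. *)
Definition representable (m : nat) : Prop :=
  forall (L : fieldType) (conj : involutive_rmorphism L) (n : nat) (le_nm : (n <= m)%N)
    (f : {mpoly L[m]}), map_mpoly conj f = f ->
  (forall v, v \in msupp f ->
     (mdeg v <= n)%N /\ forall i : 'I_n, (v (widen_ord le_nm i) <= 1)%N) ->
  f@_(mnm_first m n) = 1 ->
  (forall i j : 'I_n, exists g,
     rayleigh (widen_ord le_nm i) (widen_ord le_nm j) f = g * map_mpoly conj g) ->
  exists b : 'M[{mpoly L[m]}]_n, [/\ hermitian (map_mpoly conj) b,
    forall i j, affine_off (widen_ord le_nm) (b i j) &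
    f = \det (pencil (widen_ord le_nm) 1 b)].

Lemma mderiv_map_mpoly (R S : nzRingType) (f : {rmorphism R -> S}) m (k : 'I_m)
    (g : {mpoly R[m]}) :
  mderiv k (map_mpoly f g) = map_mpoly f (mderiv k g).
Proof.
by apply/mpolyP => v; rewrite mcoeff_mderiv !mcoeff_map_mpoly mcoeff_mderiv /= raddfMn.
Qed.

Lemma map_mpoly_comm (R S : nzRingType) (f : {rmorphism R -> S})
    (g : {rmorphism R -> R}) (h : {rmorphism S -> S}) m (p : {mpoly R[m]}) :
  (forall c, h (f c) = f (g c)) ->
  map_mpoly h (map_mpoly f p) = map_mpoly f (map_mpoly g p).
Proof. by move=> fgh; apply/mpolyP => v; rewrite !mcoeff_map_mpoly /= fgh. Qed.

Lemma map_pencil (R S : nzRingType) (f : {rmorphism R -> S}) m n (x : 'I_n -> 'I_m)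
    (c : R) (b : 'M[{mpoly R[m]}]_n) :
  map_mx (map_mpoly f) (pencil x c b) = pencil x (f c) (map_mx (map_mpoly f) b).
Proof.
apply/matrixP => i j; rewrite !mxE rmorphD /= rmorphMn /= map_mpolyZ.
by rewrite map_mpolyX.
Qed.

Lemma pencilZ (R : nzRingType) m n (x : 'I_n -> 'I_m)
    (c e : R) (b b' : 'M[{mpoly R[m]}]_n) : (forall i j, b' i j = c *: b i j) ->
  pencil x (c * e) b' = c%:MP *: pencil x e b.
Proof.
move=> b'E; apply/matrixP => i j; rewrite !mxE b'E mulrDr !mul_mpolyC.
by rewrite -scalerMnr scalerA.
Qed.

Lemma rayleigh_split_last (L : fieldType) m (i j : 'I_m) (f : {mpoly L[m.+1]}) :
  split_last (rayleigh (lift ord_max i) (lift ord_max j) f) =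
  mderiv i (split_last f) * mderiv j (split_last f)
  - split_last f * mderiv i (mderiv j (split_last f)).
Proof.
apply: etrans (rmorphB _ _ _) _; rewrite !split_last_deriv; congr (_ - _).
  exact: rmorphM.
exact: rmorphM.
Qed.

Lemma rayleigh_map (R : nzRingType) (L : fieldType) (kappa : {rmorphism R -> L}) m
    (i j : 'I_m) (c : L) (F : {mpoly R[m]}) :
  rayleigh i j (c *: map_mpoly kappa F) =
  c ^+ 2 *: map_mpoly kappa (mderiv i F * mderiv j F - F * mderiv i (mderiv j F)).
Proof.
rewrite /rayleigh !mderivZ !mderiv_map_mpoly rmorphB !rmorphM /=.
by rewrite -!scalerAl -!scalerAr !scalerA scalerBr.
Qed.

(** The induction hypothesis over the fraction field of [L[t]] represents [F / u]; after clearing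
    denominators, [descent] leaves only the denominator [u]. *)
Lemma descend_variable m (L : fieldType) (conj : involutive_rmorphism L) n
    (le_nm : (n <= m)%N) (f : {mpoly L[m.+1]}) (u : {poly L})
    (lft := fun i => lift ord_max (widen_ord le_nm i)) :
  representable m -> map_mpoly conj f = f -> u != 0 ->
  (split_last f)@_(mnm_first m n) = u ->
  (forall v, v \in msupp (split_last f) ->
     (mdeg v <= n)%N /\ forall i : 'I_n, (v (widen_ord le_nm i) <= 1)%N) ->
  (forall i j : 'I_n, exists g,
     rayleigh (lft i) (lft j) f = g * map_mpoly conj g) ->
  exists b, representation conj (widen_ord le_nm) u (split_last f) 1 b.
Proof.
move=> IH f_real u_neq0 uE f_supp f_ray.
set x := widen_ord le_nm.
have [F FE] : exists F, F = split_last f by exists (split_last f).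
have x_inj : injective x by move=> i j /(congr1 val) /= ij; apply: val_inj.
pose tofrac : {rmorphism {poly L} -> {fraction {poly L}}} := @FracField.tofrac {poly L}.
pose cP : involutive_rmorphism {poly L} := poly_conj conj.
pose cQ : involutive_rmorphism {fraction {poly L}} := fraction_conj cP.
pose kappa : {rmorphism {mpoly {poly L}[m]} -> {mpoly {fraction {poly L}}[m]}} :=
  map_mpoly tofrac.
have tofrac_inj : injective tofrac by move=> p q /eqP; rewrite tofrac_eq => /eqP.
have kappa_inj : injective kappa.
  exact: map_mpoly_inj.
have kappa_conj g : map_mpoly cQ (kappa g) = kappa (map_mpoly cP g).
  by apply: map_mpoly_comm => a; apply: fraction_conj_tofrac.
have F_real : map_mpoly cP F = F.
  by rewrite FE -[in RHS]f_real; apply/esym/split_last_map.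
have u_real : cP u = u by rewrite -uE -FE -[in RHS]F_real mcoeff_map_mpoly.
have uF_neq0 : tofrac u != 0 by rewrite tofrac_eq0.
pose c := (tofrac u)^-1.
have c_neq0 : c != 0 by rewrite invr_eq0.
have c_real : cQ c = c by rewrite /c fmorphV /= fraction_conj_tofrac u_real.
rewrite -FE in uE f_supp *.
have conj_cF g : map_mpoly cQ (c *: kappa g) = c *: kappa (map_mpoly cP g).
  by apply: etrans (map_mpolyZ _ _ _) _; rewrite kappa_conj; congr (_ *: _).
have supp_cF : msupp (c *: kappa F) =i msupp F.
  by move=> v; rewrite (perm_mem (msuppZ _ c_neq0)) (perm_mem (msupp_map_mpoly _ tofrac_inj)).
(* Division by [u] makes the leading coefficient one. As [u] is fixed by the conjugation, a Rayleigh
   difference divided by [u ^+ 2] is still a Hermitian square. *)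
have [|v|||A [A_herm A_aff detA]] := IH _ cQ n le_nm (c *: kappa F).
- by rewrite conj_cF F_real.
- by rewrite supp_cF; apply: f_supp.
- rewrite mcoeffZ; apply: etrans (mulVf uF_neq0); congr (_ * _).
  by rewrite -uE; apply: mcoeff_map_mpoly.
- move=> i j; have [g fg] := f_ray i j; exists (c *: kappa (split_last g)).
  rewrite rayleigh_map FE -rayleigh_split_last fg [split_last _]rmorphM.
  rewrite (rmorphM kappa) conj_cF -scalerAl -scalerAr scalerA.
  by congr (_ *: (_ * kappa _)); apply: split_last_map.
have [d [b0 d_neq0 b0E]] := clear_denominators A.
(* The common denominator [d] is replaced by its norm, which the conjugation fixes. *)
pose r := d * cP d.
have cd_neq0 : cP d != 0.
  by apply: contraNneq d_neq0 => cd0; rewrite -[d](rmorphK cP) cd0 rmorph0.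
have r_neq0 : r != 0 by rewrite mulf_neq0.
have r_real : cP r = r by rewrite /r rmorphM /= rmorphK mulrC.
have ur_neq0 : u * r != 0 by rewrite mulf_neq0.
pose b := \matrix_(i, j) ((u * cP d) *: b0 i j).
have bE i j : kappa (b i j) = tofrac (u * r) *: A i j.
  rewrite mxE /kappa /= map_mpolyZ b0E scalerA -rmorphM; congr (tofrac _ *: _).
  by rewrite /r -mulrA [cP d * d]mulrC.
clearbody b.
apply: (@descent L conj (rmorphK conj) m n x x_inj u F u_neq0 r b r_neq0 u_real r_real).
split=> [i j|i j|].
- apply: kappa_inj; apply: etrans (esym (kappa_conj _)) _.
  apply: etrans (congr1 (map_mpoly cQ) (bE i j)) _; apply: esym (etrans (bE j i) _).
  apply: esym (etrans (map_mpolyZ _ _ _) _); rewrite A_herm; congr (_ *: _).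
  by apply: etrans (fraction_conj_tofrac _ _) _; rewrite rmorphM /= u_real r_real.
- have kappa_b_aff : affine_off x (kappa (b i j)).
    rewrite bE -mul_mpolyC; apply/affine_offZ; last exact: A_aff.
    by rewrite tofrac_eq0.
  move=> v v_in; apply: kappa_b_aff.
  by rewrite (perm_mem (msupp_map_mpoly _ tofrac_inj)).
have lhsE : kappa (u%:MP * \det (pencil x (u * r) b)) =
    (tofrac u)%:MP * \det (pencil x (tofrac (u * r)) (map_mx kappa b)).
  rewrite [LHS]rmorphM; congr (_ * _); first exact: map_mpolyC.
  by rewrite -det_map_mx; congr determinant; apply: map_pencil.
have rhsE : kappa ((u * r)%:MP ^+ n * F) = (tofrac (u * r))%:MP ^+ n * kappa F.
  rewrite [LHS]rmorphM; congr (_ * _); rewrite [LHS]rmorphXn; congr (_ ^+ _).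
  exact: map_mpolyC.
apply: kappa_inj; apply: etrans lhsE (etrans _ (esym rhsE)).
have -> : pencil x (tofrac (u * r)) (map_mx kappa b) =
    (tofrac (u * r))%:MP *: pencil x 1 A.
  rewrite -[tofrac (u * r) in LHS]mulr1; apply: pencilZ => i j.
  by rewrite mxE bE.
rewrite detZ mulrCA; congr (_ * _).
apply: etrans (mul_mpolyC _ _) _; apply: etrans (congr1 _ (esym detA)) _.
by apply: etrans (scalerA _ _ _) _; rewrite (mulfV uF_neq0) scale1r.
Qed.

Lemma det_mx2 (R : comNzRingType) (M : 'M[R]_2) :
  \det M = M ord0 ord0 * M ord_max ord_max - M ord0 ord_max * M ord_max ord0.
Proof.
rewrite (expand_det_row _ ord0) !big_ord_recl big_ord0 addr0 /cofactor !det_mx11 !mxE /=.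
rewrite /bump /= addn0 expr0 mul1r expr1 mulN1r mulrN.
by congr (M _ _ * M _ _ - M _ _ * M _ _); apply: val_inj.
Qed.

Lemma det_mx3 (R : comNzRingType) (M : 'M[R]_3) (i0 := ord0) (i1 := lift ord0 ord0)
    (i2 := ord_max) :
  \det M = M i0 i0 * (M i1 i1 * M i2 i2 - M i1 i2 * M i2 i1)
         - M i0 i1 * (M i1 i0 * M i2 i2 - M i1 i2 * M i2 i0)
         + M i0 i2 * (M i1 i0 * M i2 i1 - M i1 i1 * M i2 i0).
Proof.
rewrite (expand_det_row _ ord0) !big_ord_recl big_ord0 addr0 /cofactor !det_mx2 !mxE /=.
rewrite /bump /= !addn0 expr0 mul1r expr1 mulN1r mulrN addn1 sqrrN expr1n mul1r addrA.
by congr (M _ _ * (M _ _ * M _ _ - M _ _ * M _ _) - M _ _ * (M _ _ * M _ _ - M _ _ * M _ _)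
  + M _ _ * (M _ _ * M _ _ - M _ _ * M _ _)); apply: val_inj.
Qed.

Lemma mdeg_first m n : mdeg (mnm_first m n) = minn m n.
Proof.
rewrite mdegE; under eq_bigr do rewrite mnmE.
elim: m => [|m IHm]; first by rewrite big_ord0 min0n.
rewrite big_ord_recr /= IHm; case: (ltnP m n) => mn.
  by rewrite (minn_idPl mn) addn1.
by rewrite (minn_idPr (leqW mn)) addn0.
Qed.

Lemma mjoin_first m n : mjoin (mnm_first m n) (m < n)%N = mnm_first m.+1 n.
Proof.
by apply/mnmP => i; rewrite !mnmE; case: unliftP => [j ->|-> //]; rewrite mnmE lift_max.
Qed.

Lemma lift_max_widen_ord m n (le_nm : (n <= m)%N) (le_nm1 : (n <= m.+1)%N) i :
  lift ord_max (widen_ord le_nm i) = widen_ord le_nm1 i.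
Proof. by apply: val_inj; apply: lift_max. Qed.

Lemma mdeg_derivs (R : nzRingType) m n (x : 'I_n -> 'I_m) (f : {mpoly R[m]}) d s :
  (forall v, v \in msupp f -> (mdeg v <= d)%N) ->
  forall v, v \in msupp (derivs x s f) -> (mdeg v + size s <= d)%N.
Proof.
move=> f_deg; elim: s => [|i s IHs] v /=; first by rewrite addn0; apply: f_deg.
rewrite mcoeff_msupp mcoeff_mderiv => fv.
have /IHs : (v + U_(x i))%MM \in msupp (derivs x s f).
  by rewrite mcoeff_msupp; apply: contraNneq fv => ->; rewrite mul0rn.
by rewrite mdegD mdeg1 addn1 addnS addSn.
Qed.

Lemma derivs_split_last (R : comNzRingType) m n (x : 'I_n -> 'I_m) (x' : 'I_n -> 'I_m.+1)
    s (f : {mpoly R[m.+1]}) : (forall i, lift ord_max (x i) = x' i) ->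
  derivs x s (split_last f) = split_last (derivs x' s f).
Proof. by move=> xE; elim: s => //= i s ->; rewrite split_last_deriv xE. Qed.

Lemma msize_leP (R : nzRingType) m (g : {mpoly R[m]}) d :
  (forall v, v \in msupp g -> (mdeg v <= d)%N) <-> (msize g <= d.+1)%N.
Proof.
split=> [g_deg|g_le v v_in]; last by rewrite -ltnS (leq_trans (msize_mdeg_lt v_in)).
by rewrite msizeE; apply/bigmax_leqP_seq => v /g_deg.
Qed.

Lemma msizeM_leq (R : idomainType) m (g h : {mpoly R[m]}) :
  (msize (g * h)%R <= (msize g + msize h).-1)%N.
Proof.
have [->|g0] := eqVneq g 0; first by rewrite mul0r msize0.
by have [->|h0] := eqVneq h 0; [rewrite mulr0 msize0 | rewrite msizeM].
Qed.

Lemma msize_map_mpoly (R S : nzRingType) (f : {rmorphism R -> S}) m (g : {mpoly R[m]}) :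
  injective f -> msize (map_mpoly f g) = msize g.
Proof. by move=> f_inj; rewrite !msizeE (perm_big _ (msupp_map_mpoly g f_inj)). Qed.

Lemma msize_hermitian_square (R : idomainType) (conj : {rmorphism R -> R}) m
    (g : {mpoly R[m]}) : injective conj ->
  (msize (g * map_mpoly conj g)%R <= 3)%N -> (msize g <= 2)%N.
Proof.
move=> conj_inj; have [->|g0] := eqVneq g 0; first by rewrite msize0.
have cg0 : map_mpoly conj g != 0.
  by rewrite -msize_poly_eq0 msize_map_mpoly // msize_poly_eq0.
rewrite msizeM // msize_map_mpoly //.
by case: (msize g) => [|[|[|s]]] //; rewrite !addSn !addnS.
Qed.

Definition pair_ord n (i j : 'I_n) (k : 'I_2) := if k == ord0 then i else j.

Lemma pair_ord_inj n (i j : 'I_n) : i != j -> injective (pair_ord i j).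
Proof.
by move=> ij [[|[|//]] ?] [[|[|//]] ?]; rewrite /pair_ord /= => E;
  apply/val_inj => //=; move: ij; rewrite E eqxx.
Qed.

Lemma entry_inj n (i : 'I_n) : injective (fun _ : 'I_1 => i).
Proof. by move=> k l _; rewrite !ord1. Qed.

(** * Small principal minors of the descended matrix *)

Section LastStep.
Variables (m : nat) (L : fieldType) (conj : involutive_rmorphism L) (n : nat).
Variables (le_nm : (n <= m)%N) (x' : 'I_n -> 'I_m.+1) (f : {mpoly L[m.+1]}).
Variables (u : {poly L}) (b : 'M[{mpoly {poly L}[m]}]_n).
Local Notation x := (widen_ord le_nm).
Hypothesis x'E : forall i, lift ord_max (x i) = x' i.
Hypothesis u_neq0 : u != 0.
Hypothesis b_rep : representation conj x u (split_last f) 1 b.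

(** With [r] equal to 1, the factor [u] cancels once: a minor of order [k.+1] is exactly [u ^+ k]
    times a derivative of [f]. *)
Lemma representation_minors k (phi : 'I_k.+1 -> 'I_n) : injective phi ->
  exists s, (size s + k.+1 = n)%N /\
    \det (mxsub phi phi (pencil x u b)) = u%:MP ^+ k * split_last (derivs x' s f).
Proof.
case: b_rep => _ b_aff; rewrite mulr1 => detb phi_inj.
have x_inj : injective x by move=> i j /(congr1 val) /= ij; apply: val_inj.
have [s [s_size sE]] := pencil_minors x_inj u_neq0 b_aff detb phi_inj.
exists s; split; first exact: s_size.
have uC_neq0 : u%:MP_[m] != 0 by rewrite mpolyC_eq0.
apply: (mulfI uC_neq0); rewrite sE exprS -mulrA; congr (_ * (_ * _)).
exact: derivs_split_last.
Qed.

Lemma representation_diag i : exists s, (size s + 1 = n)%N /\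
  u *: 'X_(x i) + b i i = split_last (derivs x' s f).
Proof.
have [s [s_size sE]] := representation_minors (@entry_inj n i).
exists s; split; first exact: s_size.
by move: sE; rewrite det_mx11 !mxE eqxx mulr1n expr0 mul1r.
Qed.

Lemma representation_off i j : i != j -> exists r, (size r + 2 = n)%N /\
  b i j * b j i = (u *: 'X_(x i) + b i i) * (u *: 'X_(x j) + b j j)
    - u%:MP * split_last (derivs x' r f).
Proof.
move=> ij; have [r [r_size rE]] := representation_minors (pair_ord_inj ij).
exists r; split; first exact: r_size.
move: rE; rewrite det_mx2 !mxE /pair_ord /= !eqxx !mulr1n (negPf ij).
rewrite [j == i]eq_sym (negPf ij) !mulr0n !add0r expr1 => <-.
by rewrite subKr.
Qed.
End LastStep.

(** Here [u] is 1, so the descended matrix already has determinant [f]. It remains to bound the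
    total degree of its entries, the last variable included. *)
Lemma extend_free_variable m (L : fieldType) (conj : involutive_rmorphism L) n
    (le_nm : (n <= m)%N) (le_nm1 : (n <= m.+1)%N) (f : {mpoly L[m.+1]}) :
  representable m -> map_mpoly conj f = f ->
  (forall v, v \in msupp f ->
     (mdeg v <= n)%N /\ forall i : 'I_n, (v (widen_ord le_nm1 i) <= 1)%N) ->
  f@_(mnm_first m.+1 n) = 1 ->
  (forall i j : 'I_n, exists g,
     rayleigh (widen_ord le_nm1 i) (widen_ord le_nm1 j) f = g * map_mpoly conj g) ->
  exists b : 'M[{mpoly L[m.+1]}]_n, [/\ hermitian (map_mpoly conj) b,
    forall i j, affine_off (widen_ord le_nm1) (b i j) &
    f = \det (pencil (widen_ord le_nm1) 1 b)].
Proof.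
move=> IH f_real f_supp f_coef f_ray.
have xE := lift_max_widen_ord le_nm le_nm1.
(* The product of the determined variables already has degree [n], so no positive power of the last
   variable can accompany it. *)
have lead1 : (split_last f)@_(mnm_first m n) = 1.
  apply/polyP => k; rewrite coef_split_last coef1; case: k => [|k] /=.
    by have := mjoin_first m n; rewrite [(m < n)%N]ltnNge le_nm /= => ->.
  apply: memN_msupp_eq0; apply/negP => /f_supp[].
  by rewrite mdeg_mjoin mdeg_first (minn_idPr le_nm) addnS ltnNge leq_addr.
have [||b b_rep] := @descend_variable m L conj n le_nm f 1 IH f_real (oner_neq0 _) lead1.
- move=> v /msupp_split_last[k /f_supp[v_deg v_aff]]; split=> [|i].
    by apply: leq_trans v_deg; rewrite mdeg_mjoin leq_addr.
  by rewrite -(mjoin_lift v k) xE.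
- by move=> i j; rewrite !xE.
have [b_herm b_aff] := b_rep; rewrite mulr1 expr1n !mul1r => detb.
have /fin_all_exists[B' B'E] (ij : 'I_n * 'I_n) := split_last_surj (b ij.1 ij.2).
pose B := \matrix_(i, j) B' (i, j).
have BE i j : split_last (B i j) = b i j by rewrite mxE B'E.
clearbody B; clear B' B'E.
have B_herm : hermitian (map_mpoly conj) B.
  move=> i j; apply: split_last_inj; apply: etrans (split_last_map _ _) _.
  by rewrite !BE; apply: b_herm.
have derivs_size s k : (size s + k = n)%N -> (msize (derivs (widen_ord le_nm1) s f) <= k.+1)%N.
  move=> s_size; apply/msize_leP => v v_in.
  have := mdeg_derivs (fun v v_in => proj1 (f_supp v v_in)) v_in.
  by rewrite -[X in (_ <= X)%N -> _]s_size addnC leq_add2l.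
(* [msize] is the total degree plus one. A diagonal entry is a derivative of order [n - 1] minus a
   variable; an off-diagonal entry times its conjugate has degree at most 2, by the 2x2 minors. *)
have B_size i j : (msize (B i j) <= 2)%N.
  have [->|ij] := eqVneq i j.
    have [s [s_size sE]] := representation_diag xE (oner_neq0 _) b_rep j.
    suff -> : B j j = derivs (widen_ord le_nm1) s f - 'X_(widen_ord le_nm1 j).
      apply: leq_trans (msizeD_le _ _) _; rewrite msizeN msizeX mdeg1 geq_max.
      by rewrite (derivs_size _ _ s_size).
    apply: split_last_inj; rewrite [RHS]rmorphB BE /= -sE -xE split_last_lift.
    by rewrite scale1r addrC addKr.
  have [r [r_size E]] := representation_off xE (oner_neq0 _) b_rep ij.
  have [s [s_size sE]] := representation_diag xE (oner_neq0 _) b_rep i.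
  have [t [t_size tE]] := representation_diag xE (oner_neq0 _) b_rep j.
  apply: (msize_hermitian_square (inv_inj (rmorphK conj))).
  have -> : B i j * map_mpoly conj (B i j) =
      derivs (widen_ord le_nm1) s f * derivs (widen_ord le_nm1) t f -
      derivs (widen_ord le_nm1) r f.
    rewrite B_herm; apply: split_last_inj; rewrite [LHS]rmorphM [RHS]rmorphB /= !BE E.
    by rewrite sE tE mul1r; congr (_ - _); apply/esym/rmorphM.
  apply: leq_trans (msizeD_le _ _) _; rewrite msizeN geq_max (derivs_size _ _ r_size) andbT.
  apply: leq_trans (msizeM_leq _ _) _.
  have arith a c : (a <= 2 -> c <= 2 -> (a + c).-1 <= 3)%N.
    by move=> a2 c2; have := leq_add a2 c2; case: (a + c)%N.
  exact: arith (derivs_size _ _ s_size) (derivs_size _ _ t_size).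
exists B; split=> // [i j v v_in|].
  split=> [|k]; first by have /msize_leP := B_size i j; apply.
  have /b_aff[_ /(_ k) <-] : mrestr v \in msupp (b i j); last by rewrite mnmE xE.
  rewrite mcoeff_msupp -BE; apply: contraL v_in => /eqP v0.
  by rewrite mcoeff_msupp -[v]mrestrK -coef_split_last v0 coef0 eqxx.
apply: split_last_inj; rewrite -detb -det_map_mx; congr determinant.
apply/matrixP => i j; rewrite !mxE !scale1r rmorphD /= BE rmorphMn /=.
by rewrite -xE split_last_lift.
Qed.

(** * Hermitian matrices with vanishing minors of order at least two *)

Definition triple_ord n (i j k : 'I_n) (l : 'I_3) :=
  if l == ord0 then i else if l == ord_max then k else j.

Lemma triple_ord_inj n (i j k : 'I_n) : i != j -> j != k -> i != k ->
  injective (triple_ord i j k).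
Proof.
move=> ij jk ik [[|[|[|//]]] ?] [[|[|[|//]]] ?]; rewrite /triple_ord /= => E;
  apply/val_inj => //=; move: ij jk ik; rewrite E ?eqxx //.
Qed.

(* The two 3-cycle products of [A] have the same sum and product as twice the
   product of the diagonal entries, hence both are equal to it. *)
Lemma hermitian_rank_one (L : fieldType) (conj : {rmorphism L -> L}) n (A : 'M[L]_n) :
  involutive conj -> hermitian conj A -> (forall i, exists h, A i i = - (h * conj h)) ->
  (forall k (phi : 'I_k.+2 -> 'I_n), injective phi -> \det (mxsub phi phi A) = 0) ->
  exists w, forall i j, A i j = - (conj (w i) * w j).
Proof.
move=> conjK A_herm A_norm A_minors.
have minor2 i j : i != j -> A i i * A j j = A i j * A j i.
  move=> ij; have := A_minors _ _ (pair_ord_inj ij).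
  by rewrite det_mx2 !mxE /pair_ord /=; apply: subr0_eq.
have A_eq0 i j : A i j * A j i = 0 -> A i j = 0.
  by rewrite -(A_herm i j) => /eqP; rewrite mulf_eq0 fmorph_eq0 orbb => /eqP.
(* If the diagonal is zero, the 2x2 minors force the whole matrix to vanish. *)
have [/existsP[o Ao]|/existsPn A0] := boolP [exists o, A o o != 0]; last first.
  exists (fun _ => 0) => i j; rewrite mulr0 oppr0.
  have Aii k : A k k = 0 by apply/eqP; have := A0 k; rewrite negbK.
  have [->|ij] := eqVneq i j; first exact: Aii.
  by apply: A_eq0; rewrite -minor2 // Aii mul0r.
have A_prod i j : A i j * A o o = A i o * A o j.
  have [->|io] := eqVneq i o; first by rewrite mulrC.
  have [->|jo] := eqVneq j o; first by [].
  have [<-|ij] := eqVneq i j; first by apply: minor2.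
  have oi : o != i by rewrite eq_sym.
  have oj : o != j by rewrite eq_sym.
  have [[pq pr] qr] := (minor2 _ _ oi, minor2 _ _ oj, minor2 _ _ ij).
  have := A_minors _ _ (triple_ord_inj oi ij oj).
  rewrite det_mx3 !mxE /triple_ord /=.
  move: Ao pq pr qr (A_eq0 i j) (A_eq0 i o) (A_eq0 o j).
  move: (A o o) (A i i) (A j j) (A i j) (A j i) (A o i) (A i o) (A o j) (A j o).
  move=> p q r aij aji aoi aio aoj ajo p0 pq pr qr ij0 io0 oj0 det0.
  (* If [q * r] vanishes, the 2x2 minors give [aij = 0] and one of [aio], [aoj] zero. *)
  have [qr0|qr_neq0] := eqVneq (q * r) 0.
    rewrite ij0 -?qr // mul0r.
    have /orP[/eqP q0|/eqP r0] : (q == 0) || (r == 0) by rewrite -mulf_eq0 qr0.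
      by rewrite io0 ?mul0r // mulrC -pq q0 mulr0.
    by rewrite oj0 ?mulr0 // -pr r0 mulr0.
  have t_sum : aoi * aij * ajo + aoj * aio * aji = (p * q * r) *+ 2.
    apply/subr0_eq; rewrite -det0 qr.
    have -> : p * q * r *+ 2 = aoi * aio * r + aoj * ajo * q by rewrite -pq -pr; ring.
    by ring.
  have t_prod : aoi * aij * ajo * (aoj * aio * aji) = (p * q * r) ^+ 2.
    have -> : (p * q * r) ^+ 2 = (p * q) * (p * r) * (q * r) by ring.
    by rewrite pq pr qr; ring.
  (* The square of the difference vanishes; this argument is valid in every characteristic. *)
  have tE : aoi * aij * ajo = p * q * r.
    apply/subr0_eq/eqP; rewrite -sqrf_eq0.
    have -> : (aoi * aij * ajo - p * q * r) ^+ 2 =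
        (p * q * r) ^+ 2 - aoi * aij * ajo * (aoj * aio * aji)
        + aoi * aij * ajo * (aoi * aij * ajo + aoj * aio * aji - (p * q * r) *+ 2) by ring.
    by rewrite t_prod t_sum !subrr mulr0 addr0.
  have oi_neq0 : aoi != 0.
    move: qr_neq0; apply: contraNneq => oi0; rewrite oi0 mul0r in pq.
    by move/eqP: pq; rewrite mulf_eq0 (negPf p0) /= => /eqP->; rewrite mul0r.
  have jo_neq0 : ajo != 0.
    move: qr_neq0; apply: contraNneq => jo0; rewrite jo0 mulr0 in pr.
    by move/eqP: pr; rewrite mulf_eq0 (negPf p0) /= => /eqP->; rewrite mulr0.
  apply: (mulfI (mulf_neq0 oi_neq0 jo_neq0)).
  have -> : aoi * ajo * (aij * p) = aoi * aij * ajo * p by ring.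
  have -> : aoi * ajo * (aio * aoj) = (aoi * aio) * (aoj * ajo) by ring.
  by rewrite tE -pq -pr; ring.
have [h hE] := A_norm o.
have h_neq0 : h != 0 by apply: contraNneq Ao => h0; rewrite hE h0 mul0r oppr0.
have ch_neq0 : conj h != 0 by rewrite fmorph_eq0.
(* As [A o o] is minus [h * conj h], the product of [conj (w i)] and [w j] is [A i o * A o j]
   divided by minus [A o o]. *)
exists (fun j => A o j / conj h) => i j; apply: (mulIf Ao).
by rewrite A_prod fmorph_div A_herm conjK hE mulrNN mulrACA !divfK.
Qed.

Lemma multiaffine_in_derivs (R : comNzRingType) m n (x : 'I_n -> 'I_m) s (k : 'I_m)
    (f : {mpoly R[m]}) : multiaffine_in k f -> multiaffine_in k (derivs x s f).
Proof. by move=> f_aff; elim: s => //= i s; apply: multiaffine_in_deriv. Qed.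

Lemma poly_size2_XaddC (R : comNzRingType) (p : {poly R}) (a : R) : (size p <= 2)%N ->
  p = (p`_1)%:P * ('X + a%:P) + p.[- a]%:P.
Proof.
move=> p2; have pE : p = (p`_1)%:P * 'X + (p`_0)%:P.
  apply/polyP => k; rewrite coefD coefMX coefC coefC.
  case: k => [|[|k]] /=; rewrite ?add0r ?addr0 //.
  by rewrite nth_default // (leq_trans p2).
rewrite {3}pE !hornerE {1}pE mulrDr -addrA; congr (_ + _).
by rewrite -polyCM -polyCD mulrN addNKr.
Qed.

Lemma derivs_rayleigh (L : fieldType) (conj : {rmorphism L -> L}) m n (x : 'I_n -> 'I_m)
    (i j : 'I_m) s (f : {mpoly L[m]}) :
  (forall k, multiaffine_in (x k) f) -> (exists g, rayleigh i j f = g * map_mpoly conj g) ->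
  exists g, rayleigh i j (derivs x s f) = g * map_mpoly conj g.
Proof.
move=> f_aff f_ray; elim: s => //= k s [g gE].
by apply: rayleigh_deriv gE; apply: multiaffine_in_derivs.
Qed.

(** * The descended matrix when all variables are determined *)

Section DeterminedVariable.
Variables (m : nat) (L : fieldType) (conj : involutive_rmorphism L).
Variables (f : {mpoly L[m.+1]}) (a : L) (b : 'M[{mpoly {poly L}[m]}]_m).
Local Notation x := (widen_ord (leqnn m)).
Local Notation x' := (lift ord_max).
Local Notation u := ('X + a%:P).
Hypothesis a_real : conj a = a.
Hypothesis f_aff : multiaffine_in ord_max f.
Hypothesis b_rep : representation conj x u (split_last f) 1 b.

Let xE i : x i = i. Proof. exact: val_inj. Qed.
Let x'E i : lift ord_max (x i) = x' i. Proof. by rewrite xE. Qed.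
Let u_neq0 : u != 0. Proof. by rewrite -size_poly_eq0 size_XaddC. Qed.

Definition const_entry i j : {poly L} := (b i j)@_0%MM.
Local Notation c := const_entry.

(** Every variable other than the last is one of the [x i], so an entry free of them is a polynomial
    in the last variable alone. *)
Lemma entryE i j : b i j = (c i j)%:MP.
Proof.
have [_ b_aff _] := b_rep; apply/mpolyP => v; rewrite mcoeffC.
have [->|v0] := eqVneq v 0%MM; first by rewrite mulr1.
rewrite mulr0; apply/eqP; rewrite mcoeff_eq0; apply: contra v0 => /b_aff[_ v_eq0].
by apply/eqP/mnmP => k; rewrite mnm0E -(xE k).
Qed.

Lemma const_entry_herm i j : map_poly conj (c i j) = c j i.
Proof. by have [b_herm _ _] := b_rep; rewrite /c -(b_herm i j) mcoeff_map_mpoly. Qed.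

Lemma size_split_const s : (size (split_last (derivs x' s f))@_0%MM <= 2)%N.
Proof.
apply/leq_sizeP => k k2; rewrite coef_split_last; apply: memN_msupp_eq0.
apply/negP => /(multiaffine_in_derivs f_aff).
by rewrite mjoin_max leqNgt k2.
Qed.

Let mcoeff0M : {morph (@mcoeff m {poly L} 0%MM) : g h / g * h}.
Proof. by move=> g h; rewrite rmorphM. Qed.

Lemma mcoeff0_diag i : (u *: 'X_(x i) + b i i)@_0%MM = c i i.
Proof. by rewrite mcoeffD mcoeffZ mcoeffX mnm1_eq0 mulr0 add0r. Qed.

(** Diagonal entries come from derivatives of [f], of degree at most 1 in the last variable; by the
    2x2 minors, an off-diagonal entry times its conjugate has degree at most 2. *)
Lemma size_const_entry i j : (size (c i j) <= 2)%N.
Proof.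
have diag k : (size (c k k) <= 2)%N.
  have [s [_ sE]] := representation_diag x'E u_neq0 b_rep k.
  by rewrite -mcoeff0_diag sE size_split_const.
have [->|ij] := eqVneq i j; first exact: diag.
apply: (size_hermitian_square (inv_inj (rmorphK conj))).
have [r [_ rE]] := representation_off x'E u_neq0 b_rep ij.
have -> : c i j * map_poly conj (c i j) =
    c i i * c j j - u * (split_last (derivs x' r f))@_0%MM.
  rewrite const_entry_herm /c -mcoeff0M rE mcoeffB !mcoeff0M !mcoeff0_diag.
  by rewrite mcoeffC eqxx mulr1.
apply: leq_trans (size_polyD _ _) _; rewrite size_polyN geq_max.
by rewrite !size2M ?diag ?size_split_const ?size_XaddC.
Qed.

(** Evaluation at [- a], the root of [u], is reduction modulo [u]. *)
Definition residue_mx := \matrix_(i, j) (c i j).[- a].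
Local Notation A := residue_mx.

Lemma const_entryE i j : c i j = ((c i j)`_1)%:P * u + (A i j)%:P.
Proof. by rewrite mxE; apply/poly_size2_XaddC/size_const_entry. Qed.

Lemma residue_mx_herm : hermitian conj A.
Proof.
have aN : conj (- a) = - a by rewrite rmorphN /= a_real.
by move=> i j; rewrite !mxE -(const_entry_herm i j) -{2}aN horner_map.
Qed.

(** A minor of order [k.+2] carries the factor [u ^+ k.+1], which vanishes at [- a]. The evaluation
    [ev] also sets the variables to zero, leaving only the constant entries. *)
Lemma residue_mx_minors k (phi : 'I_k.+2 -> 'I_m) : injective phi ->
  \det (mxsub phi phi A) = 0.
Proof.
move=> phi_inj; have [s [_ sE]] := representation_minors x'E u_neq0 b_rep phi_inj.
pose ev : {rmorphism {mpoly {poly L}[m]} -> L} :=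
  horner_eval (- a) \o @mcoeff m {poly L} 0%MM.
have ev_u : ev u%:MP = 0.
  by rewrite /ev /= mcoeffC eqxx mulr1 /horner_eval !hornerE addNr.
have : ev (\det (mxsub phi phi (pencil x u b))) = 0.
  by rewrite sE rmorphM rmorphXn ev_u exprS !mul0r.
rewrite -det_map_mx => <-; congr determinant; apply/matrixP => i j.
rewrite !mxE /ev /= /horner_eval mcoeffD mcoeffMn mcoeffZ mcoeffX mnm1_eq0 mulr0 mul0rn.
by rewrite add0r.
Qed.

(** Differentiating [f] down to [x_i] and the last variable [t] gives
    [G = (x_i + al) * (t + a) + A i i], whose Rayleigh difference is minus [A i i]. It is a
    Hermitian square because derivatives inherit this property from [f]; taking constant terms gives
    [h]. *)
Lemma residue_mx_norm : (forall k, multiaffine_in (x' k) f) ->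
  (forall i, exists g, rayleigh (x' i) ord_max f = g * map_mpoly conj g) ->
  forall i, exists h, A i i = - (h * conj h).
Proof.
move=> f_aff' f_ray i.
have [s [_ sE]] := representation_diag x'E u_neq0 b_rep i.
have [g gE] := derivs_rayleigh s f_aff' (f_ray i).
set G := derivs x' s f in sE gE.
pose Y : {mpoly L[m.+1]} := 'X_ord_max + a%:MP; pose al := (c i i)`_1.
have GE : G = ('X_(x' i) + al%:MP) * Y + (A i i)%:MP.
  apply: split_last_inj; rewrite -sE xE entryE {1}const_entryE.
  have -> : split_last (('X_(x' i) + al%:MP) * Y + (A i i)%:MP) =
      ('X_i + (al%:P)%:MP) * u%:MP + ((A i i)%:P)%:MP.
    rewrite [LHS]rmorphD /= split_lastC; congr (_ + _).
    rewrite [LHS]rmorphM /=; congr (_ * _).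
      by rewrite [LHS]rmorphD /= split_lastC split_last_lift.
    by rewrite [LHS]rmorphD /= split_lastC split_last_max mpolyCD.
  rewrite -/al [(al%:P * u + _)%:MP]mpolyCD mpolyCM mulrDl -mul_mpolyC.
  by rewrite [u%:MP * _]mulrC addrA.
have dmax : mderiv ord_max G = 'X_(x' i) + al%:MP.
  rewrite GE mderivD mderivM !mderivD !mderivC !mderivX !mnm1E eqxx addr0 addr0.
  rewrite [x' i == ord_max]eq_sym (negPf (neq_lift _ _)) scale0r addr0 mul0r add0r.
  rewrite scale1r (_ : (U_(ord_max) - U_(ord_max))%MM = 0%MM) ?mpolyX0 ?addr0 ?mulr1 //.
  by apply/mnmP => l; rewrite mnmBE subnn mnm0E.
have di : mderiv (x' i) G = Y.
  rewrite GE mderivD mderivM !mderivD !mderivC !mderivX !mnm1E eqxx addr0 addr0.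
  rewrite (negPf (neq_lift _ _)) scale0r addr0 mulr0 addr0.
  rewrite scale1r (_ : (U_(x' i) - U_(x' i))%MM = 0%MM) ?mpolyX0 ?addr0 ?mul1r //.
  by apply/mnmP => l; rewrite mnmBE subnn mnm0E.
have dimax : mderiv (x' i) (mderiv ord_max G) = 1.
  rewrite dmax mderivD mderivC addr0 mderivX mnm1E eqxx scale1r.
  rewrite (_ : (U_(x' i) - U_(x' i))%MM = 0%MM) ?mpolyX0 //.
  by apply/mnmP => l; rewrite mnmBE subnn mnm0E.
exists g@_0%MM; have := congr1 (mcoeff 0%MM) gE.
rewrite /rayleigh dimax di dmax mulr1 GE mulrC opprD addrA subrr add0r.
by rewrite rmorphM /= mcoeff_map_mpoly mcoeffN mcoeffC eqxx mulr1 => <-; rewrite opprK.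
Qed.
End DeterminedVariable.

(* The Schur complement of the bordered matrix [u w; w^* Y] is [Y - w^* w / u]. *)
Lemma det_bordered (R : idomainType) m (u : R) (w cw : 'I_m -> R) (Y Z : 'M[R]_m) :
  u != 0 -> (forall i j, Z i j = u * Y i j - cw i * w j) ->
  u ^+ m * \det (block_mx u%:M (\row_j w j) (\col_i cw i) Y : 'M_(1 + m)) = u * \det Z.
Proof.
move=> u_neq0 ZE.
pose T : 'M[R]_(1 + m) := block_mx 1%:M (- \row_j w j) 0 u%:M.
have detT : \det T = u ^+ m by rewrite det_ublock !det_scalar expr1 mul1r.
have E : block_mx u%:M (\row_j w j) (\col_i cw i) Y *m T =
    block_mx u%:M 0 (\col_i cw i) Z.
  rewrite mulmx_block !mulmx1 !mulmx0 !addr0; congr (block_mx _ _ _ _).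
    by rewrite mulmxN mul_scalar_mx mul_mx_scalar addNr.
  apply/matrixP => i j; rewrite mul_mx_scalar !mxE big_ord1 !mxE ZE.
  by rewrite mulrN addrC.
by rewrite mulrC -detT -det_mulmx E det_lblock det_scalar expr1.
Qed.

(** Modulo [u] the descended matrix is minus a rank-one Hermitian square. Bordering the quotient by
    [u] and the vector [w] therefore gives a constant Hermitian matrix plus the diagonal of the
    variables. *)
Lemma extend_determined_variable m (L : fieldType) (conj : involutive_rmorphism L)
    (le_mm : (m.+1 <= m.+1)%N) (f : {mpoly L[m.+1]}) :
  representable m -> map_mpoly conj f = f ->
  (forall v, v \in msupp f -> forall i : 'I_m.+1, (v i <= 1)%N) ->
  f@_(mnm_first m.+1 m.+1) = 1 ->
  (forall i j : 'I_m.+1, exists g, rayleigh i j f = g * map_mpoly conj g) ->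
  exists b : 'M[{mpoly L[m.+1]}]_m.+1, [/\ hermitian (map_mpoly conj) b,
    forall i j, affine_off (widen_ord le_mm) (b i j) &
    f = \det (pencil (widen_ord le_mm) 1 b)].
Proof.
move=> IH f_real f_supp f_coef f_ray.
have f_aff i : multiaffine_in i f by move=> v /f_supp.
pose a := f@_(mjoin (mnm_first m m) 0).
have a_real : conj a = a by rewrite /a -[in RHS]f_real mcoeff_map_mpoly.
pose u : {poly L} := 'X + a%:P.
have u_neq0 : u != 0 by rewrite -size_poly_eq0 size_XaddC.
have lead_u : (split_last f)@_(mnm_first m m) = u.
  apply/polyP => k; rewrite coef_split_last coefD coefX coefC.
  case: k => [|[|k]] /=; rewrite ?add0r ?addr0 //.
    rewrite -f_coef -mjoin_first ltnSn; congr (f@_(mjoin _ _)).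
    by apply/mnmP => i; rewrite !mnmE ltn_ord ltnS ltnW.
  apply: memN_msupp_eq0; apply/negP => /f_supp /(_ ord_max).
  by rewrite mjoin_max.
have [||b b_rep] := @descend_variable m L conj m (leqnn m) f u IH f_real u_neq0 lead_u.
- move=> v /msupp_split_last[k /f_supp v_aff].
  have v_le i : (v i <= 1)%N by rewrite -(mjoin_lift v k).
  split=> [|i]; last exact: v_le.
  rewrite mdegE -[leqRHS]card_ord -sum1_card; exact: leq_sum.
- by move=> i j; apply: f_ray.
have [w wE] := hermitian_rank_one (rmorphK conj) (residue_mx_herm a_real b_rep)
  (residue_mx_norm (f_aff ord_max) b_rep (fun k => f_aff _) (fun i => f_ray _ _))
  (residue_mx_minors b_rep).
have cE := const_entryE (f_aff ord_max) b_rep.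
pose c := const_entry b; pose al i j := (c i j)`_1.
have al_herm i j : conj (al i j) = al j i.
  by rewrite /al /c -(const_entry_herm b_rep i j) coef_map.
pose v i := unlift (@ord_max m) i.
(* The last row and column hold the border [w] and its conjugate, with the constant term [a] of [u]
   in the corner. *)
pose B : 'M[L]_m.+1 := \matrix_(i, j)
  match v i, v j with
  | Some i', Some j' => al i' j'
  | Some i', None => conj (w i')
  | None, Some j' => w j'
  | None, None => a
  end.
have B_herm i j : conj (B i j) = B j i.
  by rewrite !mxE; case: (v i) => [i'|]; case: (v j) => [j'|]; rewrite ?rmorphK.
exists (map_mx (@mpolyC m.+1 L) B); split=> [i j|i j|].
- by rewrite ![map_mx _ _ _ _]mxE -(B_herm i j); apply: map_mpolyC.
- by rewrite mxE; apply: affine_offC.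
pose Y : 'M[{mpoly L[m.+1]}]_m :=
  \matrix_(i, j) ('X_(lift ord_max i) *+ (i == j) + (al i j)%:MP).
pose N : 'M[{mpoly L[m.+1]}]_(1 + m) := block_mx ('X_ord_max + a%:MP)%:M
  (\row_j (w j)%:MP) (\col_i (conj (w i))%:MP) Y.
(* The last index becomes the first block, to match the shape in [det_bordered]; a simultaneous
   permutation of rows and columns keeps the determinant. *)
pose phi (i : 'I_m.+1) : 'I_(1 + m) :=
  if v i is Some i' then rshift 1 i' else lshift m ord0.
have phi_inj : injective phi.
  move=> i j; rewrite /phi /v; case: unliftP => [i' ->|->]; case: unliftP => [j' ->|->] //.
  by move/rshift_inj->.
have -> : pencil (widen_ord le_mm) 1 (map_mx (@mpolyC m.+1 L) B) = mxsub phi phi N.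
  have wid i : widen_ord le_mm i = i by apply: val_inj.
  apply/matrixP => i j; rewrite [RHS]mxE pencilE [map_mx _ _ _ _]mxE [B i j]mxE.
  rewrite scale1r wid /phi /v /N.
  case: unliftP => [i' ->|->]; case: unliftP => [j' ->|->].
  - by rewrite block_mxEdr mxE (inj_eq (@lift_inj _ _)).
  - rewrite block_mxEdl mxE eq_sym (negPf (neq_lift _ _)) mulr0n add0r //.
  - by rewrite block_mxEur mxE (negPf (neq_lift _ _)) mulr0n add0r.
  - by rewrite block_mxEul !mxE !eqxx.
rewrite det_mxsub_inj //; apply: split_last_inj; rewrite -det_map_mx.
have uC_neq0 : u%:MP_[m] != 0 by rewrite mpolyC_eq0.
pose C i j : {mpoly {poly L}[m]} := (al i j)%:P%:MP.
have -> : map_mx (@split_last L m) N = block_mx (u%:MP)%:M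
    (\row_j (w j)%:P%:MP) (\col_i (conj (w i))%:P%:MP)
    (\matrix_(i, j) ('X_i *+ (i == j) + C i j)).
  rewrite map_block_mx; congr (block_mx _ _ _ _).
  - apply/matrixP => i j; rewrite !ord1 !mxE eqxx !mulr1n.
    by rewrite [LHS]rmorphD /= split_lastC split_last_max mpolyCD.
  - by apply/matrixP => i j; rewrite !mxE split_lastC.
  - by apply/matrixP => i j; rewrite !mxE split_lastC.
  - apply/matrixP => i j; rewrite !mxE [LHS]rmorphD /= split_lastC; congr (_ + _).
    by rewrite [LHS]rmorphMn /= split_last_lift.
have [_ _] := b_rep; rewrite mulr1 => detb.
have /mulfI : u%:MP_[m] ^+ m != 0 by rewrite expf_neq0.
apply; rewrite -detb; apply/esym/det_bordered => // i j.
have wid i0 : widen_ord (leqnn m) i0 = i0 by apply: val_inj.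
have cE' : const_entry b i j = u * (al i j)%:P - (conj (w i))%:P * (w j)%:P.
  by rewrite cE wE mulrC polyCN polyCM.
rewrite !mxE wid (entryE b_rep) cE' mulrDr -addrA; congr (_ + _).
  by rewrite mul_mpolyC scalerMnr.
by rewrite mpolyCB !mpolyCM.
Qed.

(** If [n <= m], the last of the [m.+1] variables is free; otherwise [n] is [m.+1] and all variables
    are determined. *)
Lemma representable_all m : representable m.
Proof.
elim: m => [|m IHm] L conj n le_nm f f_real f_supp f_coef f_ray.
  case: n le_nm f_supp f_coef f_ray => // le_nm _ f_coef _.
  exists 0; split=> [[]|[]|] //; rewrite det_mx00 [f]nvar0_mpolyC -mpolyC1; congr _%:MP.
  by rewrite -f_coef; congr mcoeff; apply/mnmP => -[].
have [le_nm'|lt_mn] := leqP n m.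
  exact: extend_free_variable IHm f_real f_supp f_coef f_ray.
have nE : n = m.+1 by apply/eqP; rewrite eqn_leq le_nm lt_mn.
case: _ / (esym nE) le_nm f_supp f_coef f_ray => le_nm f_supp f_coef f_ray.
have wid i : widen_ord le_nm i = i by apply: val_inj.
apply: extend_determined_variable IHm f_real _ f_coef _ => [v /f_supp[_ v_aff] i|i j].
  by rewrite -(wid i).
by rewrite -{1}(wid i) -{1}(wid j).
Qed.

(** * The determinantal criterion *)

(* Differentiate [M *m \adj M = (\det M)%:M] with respect to [x_j] and multiply
   on the left by [\adj M]. *)
Lemma rayleigh_det (R : comNzRingType) n (D : 'I_n -> R -> R) (M : 'M[R]_n) i j :
  (forall i, derivation (D i)) ->
  (forall i a b, D i (M a b) = 1 *+ ((a == i) && (b == i))) ->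
  D i (\det M) * D j (\det M) - \det M * D i (D j (\det M)) =
  (\adj M) i j * (\adj M) j i.
Proof.
move=> D_deriv DM; have D_det k : D k (\det M) = (\adj M) k k.
  by rewrite (derivation_det (D_deriv k) (DM k)) mul1r.
have [DiD DiM] := D_deriv i.
pose dadj := \matrix_(a, b) D i ((\adj M) a b).
have leibniz : delta_mx i i *m \adj M + M *m dadj = (D i (\det M))%:M.
  apply/matrixP => a b; have := congr1 (D i) (congr1 (fun N : 'M[R]_n => N a b) (mul_mx_adj M)).
  rewrite !mxE (derivation_sum (D_deriv i)) => E; rewrite -big_split /=.
  transitivity (D i (\det M *+ (a == b))); last first.
    by case: (a == b); rewrite ?mulr1n // mulr0n (derivation0 (D_deriv i)).
  by rewrite -E; apply: eq_bigr => k _; rewrite DiM DM !mxE.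
have := congr1 (fun N : 'M[R]_n => (\adj M *m N) j j) leibniz.
rewrite mulmxDr !mulmxA mul_adj_mx mul_mx_scalar mul_scalar_mx => E.
move: E; rewrite [LHS]mxE [RHS]mxE [X in _ + X]mxE [dadj j j]mxE -!D_det.
rewrite [(\adj M *m delta_mx i i *m \adj M) j j]mxE.
have -> : \sum_k (\adj M *m delta_mx i i) j k * (\adj M) k j = (\adj M) j i * (\adj M) i j.
  rewrite (bigD1 i) //= big1 ?addr0 => [|k ki].
    congr (_ * _); rewrite mxE (bigD1 i) //= big1 ?addr0 ?mxE ?eqxx ?mulr1 //.
    by move=> l li; rewrite !mxE (negPf li) mulr0.
  by rewrite mxE big1 ?mul0r // => l _; rewrite [X in _ * X]mxE (negPf ki) andbF mulr0.
by move=> <-; rewrite addrK mulrC.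
Qed.

(** * Affine entries and coefficient matrices *)

Section Affine.
Variables (L : fieldType) (m n : nat) (le_nm : (n <= m)%N).
Local Notation x := (widen_ord le_nm).

Definition affine_form (c : 'I_m -> L) (c0 : L) : {mpoly L[m]} :=
  \sum_(j < m | (n <= j)%N) 'X_j * (c j)%:MP + c0%:MP.

Lemma mcoeff_affine_form c c0 v : (affine_form c c0)@_v =
  \sum_(j < m | (n <= j)%N) (U_(j)%MM == v)%:R * c j + c0 * (v == 0%MM)%:R.
Proof.
rewrite mcoeffD mcoeffC raddf_sum; congr (_ + _); apply: eq_bigr => j _ /=.
by rewrite mulrC mul_mpolyC mcoeffZ mcoeffX mulrC.
Qed.

Lemma affine_form_off c c0 : affine_off x (affine_form c c0).
Proof.
move=> v; rewrite mcoeff_msupp mcoeff_affine_form => v_in.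
have [v0|/eqP v_neq0] := v =P 0%MM.
  by rewrite v0 mdeg0; split=> // i; rewrite mnm0E.
have /existsP[j /andP[nj /eqP <-]] : [exists j : 'I_m, (n <= j)%N && (U_(j)%MM == v)].
  apply: contraR v_in => /existsPn vU; rewrite (negPf v_neq0) mulr0 addr0.
  by rewrite big1 // => j nj; have := vU j; rewrite nj /= => /negPf->; rewrite mul0r.
rewrite mdeg1; split=> // i; rewrite mnm1E; case: eqP => // ji.
by move: nj; rewrite ji /= leqNgt ltn_ord.
Qed.

(** An exponent of degree at most 1 that avoids the determined variables is zero or a unit vector at
    some [j >= n]. *)
Lemma affine_offE g : affine_off x g ->
  g = affine_form (fun j => g@_U_(j)) g@_0%MM.
Proof.
move=> g_aff; apply/mpolyP => v; rewrite mcoeff_affine_form.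
have [->|v_neq0] := eqVneq v 0%MM.
  by rewrite big1 ?add0r ?mulr1 // => j _; rewrite mnm1_eq0 mul0r.
rewrite mulr0 addr0; have [v_in|v_out] := boolP (v \in msupp g); last first.
  rewrite (memN_msupp_eq0 v_out) big1 // => j _.
  by case: eqP => [->|]; rewrite ?mul0r // (memN_msupp_eq0 v_out) mulr0.
have [v_deg v_off] := g_aff v v_in.
have /mdeg1P[k /eqP vE] : mdeg v == 1%N.
  by rewrite eqn_leq v_deg lt0n mdeg_eq0.
have nk : (n <= k)%N.
  rewrite leqNgt; apply/negP => kn; have := v_off (Ordinal kn).
  rewrite vE mnm1E (_ : widen_ord _ _ = k) ?eqxx //; exact: val_inj.
rewrite (bigD1 k) //= big1 ?addr0; first by rewrite vE eqxx mul1r.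
by move=> j /andP[_ jk]; rewrite vE eq_mnm1 (negPf jk) mul0r.
Qed.

Lemma linear_pencilE (A : 'I_m -> 'M[L]_n) (A0 : 'M[L]_n) :
  linear_pencil le_nm A A0 =
  pencil x 1 (\matrix_(i, j) affine_form (fun k => A k i j) (A0 i j)).
Proof.
apply/matrixP => i j; rewrite pencilE !mxE scale1r -addrA; congr (_ + (_ + _)).
by rewrite summxE; apply: eq_bigr => k _; rewrite !mxE.
Qed.
End Affine.

Lemma mpolyOver_fixed (K : fieldType) (conj : involutive_rmorphism K) m
    (g : {mpoly K[m]}) :
  reflect (map_mpoly conj g = g) (g \is a mpolyOver m (fixed_field conj)).
Proof.
apply: (iffP allP) => [g_fix|gE _ /mapP[v _ ->]]; last first.
  by apply/eqP; rewrite -[in RHS]gE mcoeff_map_mpoly.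
apply/mpolyP => v; rewrite mcoeff_map_mpoly.
have [v_in|v_out] := boolP (v \in msupp g).
  by apply/eqP; have := g_fix _ (map_f _ v_in); rewrite inE.
by rewrite (memN_msupp_eq0 v_out); apply: rmorph0.
Qed.

Theorem theorem5p1 (K : fieldType) (conj : involutive_rmorphism K)
    (conj_neq_id : exists a : K, conj a != a)
    (m n : nat) (le_nm : (n <= m)%N) (f : {mpoly K[m]})
    (f_over_F : f \is a mpolyOver m (fixed_field conj))
    (deg_f : msize f = n.+1)
    (f_multiaffine : multiaffine (fun i : 'I_m => (i < n)%N) f)
    (f_coef : f@_(mnm_first m n) = 1) :
  (exists (A : 'I_m -> 'M[K]_n) (A0 : 'M[K]_n),
     [/\ forall j : 'I_m, (n <= j)%N -> A j \is hermitianmx n false conj,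
         A0 \is hermitianmx n false conj
       & f = \det (linear_pencil le_nm A A0)])
  <->
  (forall i j : 'I_n,
     hermitian_square conj
       (rayleigh (widen_ord le_nm i) (widen_ord le_nm j) f)).
Proof.
have f_real := elimT (mpolyOver_fixed _ _) f_over_F.
have hermP (M : 'M[K]_n) : M \is hermitianmx n false conj <-> hermitian conj M.
  split=> [/is_hermitianmxP ME i j|M_herm].
    by rewrite [in RHS]ME expr0 scale1r !mxE.
  apply/is_hermitianmxP; rewrite expr0 scale1r; apply/matrixP => i j.
  by rewrite !mxE M_herm.
split=> [[A [A0 [A_herm A0_herm fE]]] i j|f_ray].
- split.
    apply/mpolyOver_fixed; rewrite /rayleigh rmorphB !rmorphM /=.
    by rewrite -!mderiv_map_mpoly f_real.
  (* For Hermitian [M], conjugation exchanges the [(i, j)] and [(j, i)] entries of the adjugate, so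
     [rayleigh_det] displays a Hermitian square. *)
  pose M := linear_pencil le_nm A A0; exists ((\adj M) i j).
  have M_herm : map_mx (map_mpoly conj) M = M^T.
    rewrite /M linear_pencilE map_pencil rmorph1; apply/matrixP => a b.
    rewrite [RHS]mxE !pencilE eq_sym; congr (_ + _).
      by case: eqVneq => [->|].
    rewrite !mxE rmorphD raddf_sum /= map_mpolyC.
    congr (_ + _%:MP); last by have /hermP/(_ a b) := A0_herm.
    apply: eq_bigr => k nk; rewrite rmorphM /= map_mpolyX map_mpolyC.
    by congr (_ * _%:MP); have /hermP/(_ a b) := A_herm k nk.
  have -> : map_mpoly conj ((\adj M) i j) = (\adj M) j i.
    have := congr1 (fun N : 'M_n => (\adj N) i j) M_herm.
    by rewrite -map_mx_adj -trmx_adj mxE => ->; rewrite mxE.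
  rewrite /rayleigh fE -/M.
  apply: (@rayleigh_det _ n (fun i => mderiv (widen_ord le_nm i)) M).
    by move=> k; apply: mderiv_derivation.
  move=> k a b; rewrite /M linear_pencilE; apply: mderiv_pencil.
    by move=> c d /(congr1 val) /= cd; apply: val_inj.
  by move=> c d; rewrite mxE; apply: affine_form_off.
have [|v v_in||i j|b [b_herm b_aff fE]] := @representable_all m K conj n le_nm f.
- exact: f_real.
- split=> [|i]; first by rewrite -ltnS -deg_f msize_mdeg_lt.
  exact: (f_multiaffine (widen_ord le_nm i) (ltn_ord i) v v_in).
- exact: f_coef.
- by have [_] := f_ray i j.
(* The coefficient matrices are read off from the affine entries; each is Hermitian because
   conjugation acts on coefficients. *)
exists (fun k => \matrix_(i, j) (b i j)@_U_(k)), (\matrix_(i, j) (b i j)@_0%MM).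
have b_coef_herm v : hermitian conj (\matrix_(i, j) (b i j)@_v).
  by move=> i j; rewrite !mxE -(b_herm i j) mcoeff_map_mpoly.
split=> [k _||]; try exact/hermP/b_coef_herm.
rewrite fE linear_pencilE; congr (\det (pencil _ _ _)); apply/matrixP => i j.
rewrite mxE [LHS](affine_offE (b_aff i j)) mxE; congr (_ + _).
by apply: eq_bigr => k _; rewrite mxE.
Qed.
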